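(* Let $(E,\varepsilon)$ be a (general, not necessarily Lie) algebroid over a manifold $M$, with bundle projection $\tau:E\to M$ and left and right anchors $\rho,\sigma:E\to TM$. Let $\mathcal{G}:E\times_M E\to\mathbb{R}$ be a bundle metric on $E$, let $V:M\to\mathbb{R}$ be a smooth function, and let $$L:E\to\mathbb{R},\qquad L(e)=\tfrac12\,\mathcal{G}(e,e)-V(\tau(e)).$$ Let $D\subset E$ be a vector subbundle over a submanifold $D_M\subset M$ satisfying the strong admissibility condition $\rho(D)\subset TD_M$ and $\sigma(D)\subset TD_M$. Let $D^\perp$ be the $\mathcal{G}$-orthogonal complement of $D$ in $E_{|D_M}$, let $P:E_{|D_M}=D\oplus_{D_M}D^\perp\to D$ be the orthogonal projection, let $\varepsilon_P$ be the nonholonomic restriction of $\varepsilon$ to $D$ along $P$ (an algebroid structure on $D\to D_M$), and let $l=L_{|D}:D\to\mathbb{R}$. Then the nonholonomic (constrained) Tulczyjew differential $\Lambda_L^D:D\to TD^*$ of $L$ coincides with the Tulczyjew differential $\Lambda_l=\varepsilon_P\circ \mathrm{d}l:D\to TD^*$ of $l$ on the algebroid $(D,\varepsilon_P)$. In other words, the nonholonomic Euler-Lagrange equations associated with $L$ and the nonholonomic constraint $D$ in $E$ coincide with the non-constrained Euler-Lagrange equations for the Lagrangian $l$ on the algebroid $(D,\varepsilon_P)$.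
   Context: Everything is smooth; a bundle metric is a smooth family of (positive definite) inner products on the fibres. **Algebroids.** An algebroid structure on a vector bundle $\tau:E\to M$ (dual bundle $\pi:E^*\to M$) is an $\mathbb{R}$-bilinear bracket $[\cdot,\cdot]_\varepsilon$ on sections of $E$ together with vector bundle morphisms $\rho,\sigma:E\to TM$ over $\mathrm{id}_M$ (left and right anchors) such that $$[fX,gY]_\varepsilon=f\rho(X)(g)\,Y-g\,\sigma(Y)(f)\,X+fg[X,Y]_\varepsilon$$ for functions $f,g$ on $M$ and sections $X,Y$ of $E$. No skew-symmetry or Jacobi identity is required. Equivalently, it is a morphism of double vector bundles $\varepsilon:T^*E\to TE^*$ covering the identity of $E^*$, given as follows. Let $(x^i)$ be local coordinates on $M$ and $\{e_a\}$ a local basis of sections of $E$, with induced coordinates $(x^i,y^a)$ on $E$, $(x^i,\xi_a)$ on $E^*$, $(x^i,y^a,p_j,\xi_b)$ on $T^*E$ (the covector $p_j\,\mathrm{d}x^j+\xi_b\,\mathrm{d}y^b$ at $(x,y)$) and $(x^i,\xi_a,\dot x^j,\dot\xi_b)$ on $TE^*$. Write $[e_a,e_b]_\varepsilon=\mathcal{C}^c_{ab}e_c$, $\rho(e_a)=\rho^i_a\partial_{x^i}$, $\sigma(e_a)=\sigma^i_a\partial_{x^i}$. Then (summation convention) $$\varepsilon(x^i,y^a,p_j,\xi_b)=\bigl(x^i,\ \xi_a,\ \rho^j_c(x)y^c,\ \mathcal{C}^c_{ab}(x)y^a\xi_c+\sigma^i_b(x)p_i\bigr).$$ **Euler-Lagrange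 equations on an algebroid.** For a function $L:E\to\mathbb{R}$, the Tulczyjew differential is $\Lambda_L=\varepsilon\circ \mathrm{d}L:E\to TE^*$ and the Legendre map is $\lambda_L=\tau_{E^*}\circ\Lambda_L:E\to E^*$, where $\tau_{E^*}:TE^*\to E^*$ is the tangent projection. A curve $\gamma$ in $E$ satisfies the Euler-Lagrange equations of $L$ on $(E,\varepsilon)$ if $\mathbf{t}(\lambda_L\circ\gamma)=\Lambda_L\circ\gamma$, where $\mathbf{t}\beta(t)=(\beta(t),\dot\beta(t))$ is the tangent prolongation of a curve $\beta$. **Nonholonomic Euler-Lagrange equations.** Let $D\subset E$ be a vector subbundle over a submanifold $D_M\subset M$ with $\rho(D)\subset TD_M$. Let $i_D^*:E^*_{|D_M}\to D^*$ be the map dual to the inclusion $D\hookrightarrow E_{|D_M}$. Since $\rho(D)\subset TD_M$, $\varepsilon$ maps $(T^*E)_{|D}$ into $T(E^*_{|D_M})$. The constrained Tulczyjew differential is $$\Lambda_L^D=Ti_D^*\circ\varepsilon\circ \mathrm{d}L_{\,|D}:D\to TD^*$$ (here $\mathrm{d}L$ is the differential of $L$ on $E$, evaluated at points of $D$), and the constrained Legendre map is $\lambda_L^D=i_D^*\circ\lambda_{L|D}:D\to D^*$. A curve $\gamma$ in $D$ satisfies the nonholonomic Euler-Lagrange equations of $L$ with constraint $D$ if $\mathbf{t}(\lambda_L^D\circ\gamma)=\Lambda_L^D\circ\gamma$. **Nonholonomic restriction of an algebroid.** Let $D\subset E$ be a vector subbundle over $D_M\subset M$ with $\rho(D)\subset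 TD_M$ and $\sigma(D)\subset TD_M$, and let $P:E_{|D_M}=D\oplus_{D_M}D^\perp\to D$ be the projection along a complementary subbundle $D^\perp$. For sections $X,Y$ of $D$, the restriction to $D_M$ of the bracket of any local extensions of $X,Y$ to sections of $E$ does not depend on the extensions; it is a section of $E_{|D_M}$ denoted $[X,Y]_\varepsilon$. The nonholonomic restriction $\varepsilon_P$ is the algebroid structure on $D\to D_M$ with bracket $[X,Y]_{\varepsilon_P}=P([X,Y]_\varepsilon)$ and anchors $\rho_{|D},\sigma_{|D}:D\to TD_M$; the corresponding morphism is $\varepsilon_P:T^*D\to TD^*$. *)

(* Defs.v *)
From HB Require Import structures.
From mathcomp Require Import all_boot all_order all_algebra.
From mathcomp Require Import all_classical all_reals all_analysis.

Set Implicit Arguments.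
Unset Strict Implicit.
Unset Printing Implicit Defensive.

Import Order.TTheory GRing.Theory Num.Theory.
Import numFieldNormedType.Exports.

Local Open Scope classical_set_scope.
Local Open Scope ring_scope.

(** * Smooth functions between normed spaces *)

(* On finite-dimensional spaces (the only ones used below) and for [O] open,
   [forall k, Ck k O f] says that [f] is C^oo on [O]. *)
Fixpoint Ck (R : realType) (V W : normedModType R) (k : nat) (O : set V)
    (f : V -> W) : Prop :=
  match k with
  | 0%N => forall x, O x -> {for x, continuous f}
  | k'.+1 => (forall x, O x -> differentiable f x) /\
             forall v : V, Ck k' O (fun x => 'D_v f x)
  end.

Definition smooth_on (R : realType) (V W : normedModType R) (O : set V)
    (f : V -> W) : Prop :=
  open O /\ forall k, Ck k O f.

(** * Charts, atlases, manifolds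

    The topology of a manifold is the one determined by its atlas.  Structures
    are split into raw data ([atlas], [framing], [algebroid]) and the
    propositions saying that the data satisfy the axioms, so that the manifolds
    and bundles derived below from given ones need no proofs to be defined. *)

(* [cinv] is meaningful only on the image of [cdom] under [cmap]. *)
Record chart (R : realType) (T : Type) (n : nat) := Chart {
  cdom : set T;
  cmap : T -> 'rV[R]_n;
  cinv : 'rV[R]_n -> T
}.

(* [apref] singles out a chart around each point; tangent vectors at a point
   will be represented by their components in that chart. *)
Record atlas (R : realType) (T : Type) (n : nat) := Atlas {
  aidx : Type;
  achart : aidx -> chart R T n;
  apref : T -> aidx
}.

Arguments achart {R T n} a i.

Definition chart_at (R : realType) (T : Type) (n : nat) (A : atlas R T n)
    (x : T) : chart R T n :=
  achart A (apref A x).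

Definition is_chart (R : realType) (T : Type) (n : nat) (c : chart R T n) :
    Prop :=
  open (cmap c @` cdom c) /\ forall x, cdom c x -> cinv c (cmap c x) = x.

Definition chart_compat (R : realType) (T : Type) (n : nat)
    (c c' : chart R T n) : Prop :=
  smooth_on (cmap c @` (cdom c `&` cdom c')) (cmap c' \o cinv c) /\
  smooth_on (cmap c' @` (cdom c `&` cdom c')) (cmap c \o cinv c').

Definition mopen (R : realType) (T : Type) (n : nat) (A : atlas R T n)
    (W : set T) : Prop :=
  forall i, open (cmap (achart A i) @` (cdom (achart A i) `&` W)).

Definition is_manifold (R : realType) (T : Type) (n : nat) (A : atlas R T n) :
    Prop :=
  [/\ (forall i, is_chart (achart A i)) /\
        (forall i j, chart_compat (achart A i) (achart A j)),
      (forall x, cdom (chart_at A x) x),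
      (* Hausdorff *)
      (forall x y, x <> y -> exists U W,
         [/\ mopen A U /\ mopen A W, U x, W y & U `&` W = set0]) &
      (* second countable *)
      (exists J : set (aidx A), countable J /\
         forall x, exists2 i, J i & cdom (achart A i) x)].

(* Smoothness on the open set [W] of a function with values in a normed
   space. *)
Definition smooth_fun (R : realType) (T : Type) (n : nat) (A : atlas R T n)
    (V : normedModType R) (W : set T) (f : T -> V) : Prop :=
  forall i, smooth_on (cmap (achart A i) @` (cdom (achart A i) `&` W))
                      (f \o cinv (achart A i)).

(** * Vector bundles *)

(* A bundle of rank [n] over [T] is a family of fibres together with local
   frames covering [T]. *)
Record framing (R : realType) (T : Type) (E : T -> vectType R) (n : nat) :=
  Framing {
  fidx : Type;
  fdom : fidx -> set T;
  frame : fidx -> forall x, n.-tuple (E x);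
  fpref : T -> fidx
}.

Arguments fdom {R T E n} f s.
Arguments frame {R T E n} f s x.

(* The [a]-th coordinate of [v : E x] in the local frame [s]. *)
Definition fcoord (R : realType) (T : Type) (E : T -> vectType R) (n : nat)
    (F : framing E n) (s : fidx F) (x : T) (a : 'I_n) (v : E x) : R :=
  coord (frame F s x) a v.
Arguments fcoord {R T E n} F s [x] a v.

Definition is_vbundle (R : realType) (T : Type) (m : nat) (A : atlas R T m)
    (E : T -> vectType R) (n : nat) (F : framing E n) : Prop :=
  [/\ (forall x, fdom F (fpref F x) x),
      (forall s : fidx F, mopen A (fdom F s)),
      (forall (s : fidx F) x, fdom F s x -> basis_of fullv (frame F s x)) &
      (forall (s s' : fidx F) a b,
         smooth_fun A (V:=R^o) (fdom F s `&` fdom F s')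
           (fun x => fcoord F s a (tnth (frame F s' x) b)))].

Definition section (R : realType) (T : Type) (E : T -> vectType R) : Type :=
  forall x, E x.

Definition smooth_section (R : realType) (T : Type) (m : nat)
    (A : atlas R T m) (E : T -> vectType R) (n : nat) (F : framing E n)
    (X : section E) : Prop :=
  forall (s : fidx F) a,
    smooth_fun A (V:=R^o) (fdom F s) (fun x => fcoord F s a (X x)).

(* Smoothness of a fibrewise linear map over the identity. *)
Definition smooth_morphism (R : realType) (T : Type) (m : nat)
    (A : atlas R T m) (E : T -> vectType R) (n : nat) (F : framing E n)
    (E' : T -> vectType R) (n' : nat) (F' : framing E' n')
    (phi : forall x, 'Hom(E x, E' x)) : Prop :=
  forall (s : fidx F) (s' : fidx F') a b,
    smooth_fun A (V:=R^o) (fdom F s `&` fdom F' s')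
      (fun x => fcoord F' s' b (phi x (tnth (frame F s x) a))).

Definition total_space (R : realType) (T : Type) (E : T -> vectType R) : Type :=
  {x : T & E x}.

(* The induced chart (x^i, y^a) on the total space. *)
Definition total_chart (R : realType) (T : Type) (m : nat) (c : chart R T m)
    (E : T -> vectType R) (n : nat) (F : framing E n) (s : fidx F) :
    chart R (total_space E) (m + n) :=
  Chart [set e : total_space E | cdom c (tag e) /\ fdom F s (tag e)]
    (fun e : total_space E =>
       row_mx (cmap c (tag e)) (\row_a fcoord F s a (tagged e)))
    (fun u => let x := cinv c (lsubmx u) in
       Tagged E (\sum_a rsubmx u 0 a *: tnth (frame F s x) a)).

Definition total_atlas (R : realType) (T : Type) (m : nat) (A : atlas R T m)
    (E : T -> vectType R) (n : nat) (F : framing E n) :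
    atlas R (total_space E) (m + n) :=
  Atlas (fun cs : aidx A * fidx F => total_chart (achart A cs.1) cs.2)
    (fun e => (apref A (tag e), fpref F (tag e))).

Definition dual_fib (R : realType) (T : Type) (E : T -> vectType R) :
    T -> vectType R :=
  fun x => 'Hom(E x, R^o).

(* Dual frames; the induced coordinates on the total space of the dual are
   (x^i, xi_a). *)
Definition dual_framing (R : realType) (T : Type) (E : T -> vectType R)
    (n : nat) (F : framing E n) : framing (dual_fib E) n :=
  Framing (fdom F)
    (fun s x => [tuple (linfun (fcoord F s a : E x -> R^o)
                        : dual_fib E x) | a < n])
    (fpref F).

(** * Tangent and cotangent bundles *)

(* The tangent space at [x] is 'rV_m: a tangent vector at [x] is given by its
   components in [chart_at A x]. *)
Definition tfib (R : realType) (T : Type) (m : nat) : T -> vectType R :=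
  fun _ => 'rV[R]_m.

Definition tangent (R : realType) (T : Type) (m : nat) : Type :=
  total_space (@tfib R T m).

Definition tvec (R : realType) (T : Type) (m : nat) (x : T) (v : 'rV[R]_m) :
    tangent R T m :=
  existT (@tfib R T m) x v.

Definition cotangent (R : realType) (T : Type) (m : nat) : Type :=
  total_space (dual_fib (@tfib R T m)).

(* The coordinate vector fields of the charts, as frames of the tangent
   bundle. *)
Definition tangent_framing (R : realType) (T : Type) (m : nat)
    (A : atlas R T m) : framing (@tfib R T m) m :=
  Framing (fun i : aidx A => cdom (achart A i))
    (fun i x => [tuple ('d (cmap (chart_at A x) \o cinv (achart A i))
                          (cmap (achart A i) x) (delta_mx 0 j)
                        : @tfib R T m x) | j < m])
    (apref A).

(* The tangent map T_p f : T_p S -> T_(f p) T. *)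
Definition tlin (R : realType) (S T : Type) (m n : nat) (A : atlas R S m)
    (B : atlas R T n) (f : S -> T) (p : S) : 'Hom('rV[R]_m, 'rV[R]_n) :=
  linfun ('d (cmap (chart_at B (f p)) \o f \o cinv (chart_at A p))
             (cmap (chart_at A p) p)).

Definition tmap (R : realType) (S T : Type) (m n : nat) (A : atlas R S m)
    (B : atlas R T n) (f : S -> T) (w : tangent R S m) : tangent R T n :=
  tvec (f (tag w)) (tlin A B f (tag w) (tagged w)).

(* d_x f as a linear form on the tangent space at [x]. *)
Definition dlin (R : realType) (T : Type) (m : nat) (A : atlas R T m)
    (f : T -> R) (x : T) : dual_fib (@tfib R T m) x :=
  linfun ('d (f \o cinv (chart_at A x) : 'rV[R]_m -> R^o)
             (cmap (chart_at A x) x)).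

Definition dfun (R : realType) (T : Type) (m : nat) (A : atlas R T m)
    (f : T -> R) (x : T) : cotangent R T m :=
  existT (dual_fib (@tfib R T m)) x (dlin A f x).

(* The tangent prolongation of a curve. *)
Definition tprolong (R : realType) (T : Type) (m : nat) (A : atlas R T m)
    (beta : R -> T) (t : R) : tangent R T m :=
  tvec (beta t) (derive1 (cmap (chart_at A (beta t)) \o beta) t).

Definition smooth_curve (R : realType) (T : Type) (m : nat) (A : atlas R T m)
    (I : set R) (gamma : R -> T) : Prop :=
  forall i, smooth_on (V:=R^o) (I `&` gamma @^-1` cdom (achart A i))
                      (cmap (achart A i) \o gamma).

(** * Algebroids *)

(* Only the values of [bracket] on smooth sections matter. *)
Record algebroid (R : realType) (T : Type) (m : nat) (E : T -> vectType R) :=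
  Algebroid {
  bracket : section E -> section E -> section E;
  lanchor : forall x, 'Hom(E x, @tfib R T m x);
  ranchor : forall x, 'Hom(E x, @tfib R T m x)
}.

Definition is_algebroid (R : realType) (T : Type) (m : nat) (A : atlas R T m)
    (E : T -> vectType R) (n : nat) (F : framing E n)
    (eps : algebroid m E) : Prop :=
  let sm := smooth_section A F in
  let smf := smooth_fun A (V:=R^o) setT in
  let br := bracket eps in
  [/\ smooth_morphism A F (tangent_framing A) (lanchor eps) /\
      smooth_morphism A F (tangent_framing A) (ranchor eps),
      (forall X Y, sm X -> sm Y -> sm (br X Y)),
      (forall (c : R) X X' Y, sm X -> sm X' -> sm Y -> forall x,
         br (fun z => c *: X z + X' z) Y x = c *: br X Y x + br X' Y x),
      (forall (c : R) X Y Y', sm X -> sm Y -> sm Y' -> forall x,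
         br X (fun z => c *: Y z + Y' z) x = c *: br X Y x + br X Y' x) &
      (forall (f g : T -> R) X Y, smf f -> smf g -> sm X -> sm Y -> forall x,
         br (fun z => f z *: X z) (fun z => g z *: Y z) x =
           (f x * dlin A g x (lanchor eps x (X x))) *: Y x
           - (g x * dlin A f x (ranchor eps x (Y x))) *: X x
           + (f x * g x) *: br X Y x)].

(* Some section satisfying [Q], if there is one. *)
Definition pick_section (R : realType) (T : Type) (E : T -> vectType R)
    (Q : section E -> Prop) : section E :=
  match pselect (exists X, Q X) with
  | left h => projT1 (cid h)
  | right _ => fun _ => 0
  end.

(* A global smooth section with the same germ at [x] as the local section
   [X]. *)
Definition globalize (R : realType) (T : Type) (m : nat) (A : atlas R T m)
    (E : T -> vectType R) (n : nat) (F : framing E n) (X : section E)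
    (x : T) : section E :=
  pick_section (fun X' => smooth_section A F X' /\
    exists W, [/\ mopen A W, W x & forall z, W z -> X' z = X z]).

(* The value at [x] of the bracket of sections that are smooth near [x] only;
   by the Leibniz rule it does not depend on the global sections chosen. *)
Definition local_bracket (R : realType) (T : Type) (m : nat) (A : atlas R T m)
    (E : T -> vectType R) (n : nat) (F : framing E n) (eps : algebroid m E)
    (X Y : section E) (x : T) : E x :=
  bracket eps (globalize A F X x) (globalize A F Y x) x.

(* The structure functions C^c_ab of the frame [s]. *)
Definition structure_fun (R : realType) (T : Type) (m : nat)
    (A : atlas R T m) (E : T -> vectType R) (n : nat) (F : framing E n)
    (eps : algebroid m E) (s : fidx F) (a b c : 'I_n) (x : T) : R :=
  fcoord F s c (local_bracket A F eps
    (fun z => tnth (frame F s z) a) (fun z => tnth (frame F s z) b) x).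

(* The morphism eps : T^*E -> TE^*, by its coordinate formula in the chart
   [chart_at A x] and the frame [fpref F x], i.e. in the coordinates that
   represent covectors on E and tangent vectors of E^* over [x] (the formula
   defines the same map in all coordinates). *)
Definition tulczyjew (R : realType) (T : Type) (m : nat) (A : atlas R T m)
    (E : T -> vectType R) (n : nat) (F : framing E n) (eps : algebroid m E)
    (alpha : cotangent R (total_space E) (m + n)) :
    tangent R (total_space (dual_fib E)) (m + n) :=
  let x := tag (tag alpha) in
  let s := fpref F x in
  let e a := tnth (frame F s x) a in
  let y a := fcoord F s a (tagged (tag alpha)) in
  let p (i : 'I_m) : R := tagged alpha (delta_mx 0 (lshift n i)) in
  let xi (b : 'I_n) : R := tagged alpha (delta_mx 0 (rshift m b)) in
  tvec (Tagged (dual_fib E)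
       (\sum_b xi b *: tnth (frame (dual_framing F) s x) b))
    (row_mx (\sum_c y c *: (lanchor eps x (e c) : 'rV[R]_m))
       (\row_b (\sum_a \sum_c structure_fun A eps s a b c x * y a * xi c
                + \sum_i (ranchor eps x (e b) : 'rV[R]_m) 0 i * p i))).

(** * Euler-Lagrange equations *)

Definition tulczyjew_diff (R : realType) (T : Type) (m : nat)
    (A : atlas R T m) (E : T -> vectType R) (n : nat) (F : framing E n)
    (eps : algebroid m E) (L : total_space E -> R) (e : total_space E) :
    tangent R (total_space (dual_fib E)) (m + n) :=
  tulczyjew A F eps (dfun (total_atlas A F) L e).

Definition legendre (R : realType) (T : Type) (m : nat)
    (A : atlas R T m) (E : T -> vectType R) (n : nat) (F : framing E n)
    (eps : algebroid m E) (L : total_space E -> R) (e : total_space E) :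
    total_space (dual_fib E) :=
  tag (tulczyjew_diff A F eps L e).

Definition euler_lagrange (R : realType) (T : Type) (m : nat)
    (A : atlas R T m) (E : T -> vectType R) (n : nat) (F : framing E n)
    (eps : algebroid m E) (L : total_space E -> R) (I : set R)
    (gamma : R -> total_space E) : Prop :=
  forall t, I t ->
    tprolong (total_atlas A (dual_framing F))
      (legendre A F eps L \o gamma) t = tulczyjew_diff A F eps L (gamma t).

(** * Submanifolds and subbundles *)

(* [AS] makes the subset [S] an embedded submanifold: it is the structure
   induced by slice charts [kappa], which map [S] to the subspace where the
   coordinates of index >= k vanish; multiplying by [pid_mx k] keeps the first
   [k] coordinates. *)
Definition is_submanifold (R : realType) (M : Type) (m : nat)
    (A : atlas R M m) (S : set M) (k : nat)
    (AS : atlas R {x : M | S x} k) : Prop :=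
  is_manifold AS /\
  forall y : {x : M | S x},
    exists (kappa : chart R M m) (iota : chart R {x : M | S x} k),
    [/\ is_chart kappa /\ (forall i, chart_compat kappa (achart A i)),
        is_chart iota /\ (forall i, chart_compat iota (achart AS i)),
        cdom kappa (sval y),
        (forall x, cdom kappa x ->
           (S x <-> forall i : 'I_m, (k <= i)%N -> cmap kappa x 0 i = 0)) &
        (forall z, cdom iota z <-> cdom kappa (sval z)) /\
        (forall z, cdom iota z ->
           cmap iota z = cmap kappa (sval z) *m (pid_mx k : 'M[R]_(m, k)))].

(* The restriction of a bundle to [S]. *)
Definition restr_fib (R : realType) (M : Type) (E : M -> vectType R)
    (S : set M) : {x : M | S x} -> vectType R :=
  fun y => E (sval y).

Definition restr_framing (R : realType) (M : Type) (E : M -> vectType R)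
    (n : nat) (F : framing E n) (S : set M) : framing (@restr_fib R M E S) n :=
  Framing (fun (s : fidx F) y => fdom F s (sval y))
    (fun s y => frame F s (sval y)) (fun y => fpref F (sval y)).

Definition sub_fib (R : realType) (M : Type) (E : M -> vectType R)
    (S : set M) (D : forall y : {x : M | S x}, {vspace E (sval y)}) :
    {x : M | S x} -> vectType R :=
  fun y => subvs_of (D y).

Definition sub_incl (R : realType) (M : Type) (E : M -> vectType R)
    (S : set M) (D : forall y : {x : M | S x}, {vspace E (sval y)})
    (y : {x : M | S x}) : 'Hom(sub_fib D y, restr_fib E y) :=
  linfun (vsval : subvs_of (D y) -> E (sval y)).

(* The inclusion D -> E on total spaces. *)
Definition tot_incl (R : realType) (M : Type) (E : M -> vectType R)
    (S : set M) (D : forall y : {x : M | S x}, {vspace E (sval y)})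
    (d : total_space (sub_fib D)) : total_space E :=
  Tagged E (sub_incl D (tag d) (tagged d)).

Definition is_subbundle (R : realType) (M : Type) (E : M -> vectType R)
    (n : nat) (F : framing E n) (S : set M) (k : nat)
    (AS : atlas R {x : M | S x} k)
    (D : forall y : {x : M | S x}, {vspace E (sval y)}) (r : nat)
    (FD : framing (sub_fib D) r) : Prop :=
  is_vbundle AS FD /\
  smooth_morphism AS FD (restr_framing F S) (sub_incl D).

(* T_y S -> T_y M *)
Definition tangent_incl (R : realType) (M : Type) (m : nat) (A : atlas R M m)
    (S : set M) (k : nat) (AS : atlas R {x : M | S x} k)
    (y : {x : M | S x}) : 'Hom('rV[R]_k, 'rV[R]_m) :=
  tlin AS A sval y.

(* [phi] maps [D] into the tangent bundle of [S]. *)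
Definition maps_into_tangent (R : realType) (M : Type) (m : nat)
    (A : atlas R M m) (E : M -> vectType R) (S : set M) (k : nat)
    (AS : atlas R {x : M | S x} k)
    (D : forall y : {x : M | S x}, {vspace E (sval y)})
    (phi : forall x, 'Hom(E x, @tfib R M m x)) : Prop :=
  forall y, (phi (sval y) @: D y <= limg (tangent_incl A AS y))%VS.

(** * Nonholonomic Euler-Lagrange equations *)

(* The inclusion of the restriction of E^* to [S] into E^*. *)
Definition dual_incl (R : realType) (M : Type) (E : M -> vectType R)
    (S : set M) (xi : total_space (@restr_fib R M (dual_fib E) S)) :
    total_space (dual_fib E) :=
  Tagged (dual_fib E) (tagged xi).

(* i_D^*, restricting linear forms to D. *)
Definition dual_restr (R : realType) (M : Type) (E : M -> vectType R)
    (S : set M) (D : forall y : {x : M | S x}, {vspace E (sval y)})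
    (xi : total_space (@restr_fib R M (dual_fib E) S)) :
    total_space (dual_fib (sub_fib D)) :=
  Tagged (dual_fib (sub_fib D))
    ((tagged xi : 'Hom(E (sval (tag xi)), R^o)) \o sub_incl D (tag xi))%VF.

(* Lambda_L^D.  The vector [w] is tangent to the restriction of E^* to [S];
   applying the inverse of the (injective) tangent map of the inclusion is what
   considers [w] as an element of the tangent bundle of that submanifold. *)
Definition nh_tulczyjew_diff (R : realType) (M : Type) (m : nat)
    (A : atlas R M m) (E : M -> vectType R) (n : nat) (F : framing E n)
    (S : set M) (k : nat) (AS : atlas R {x : M | S x} k)
    (D : forall y : {x : M | S x}, {vspace E (sval y)}) (r : nat)
    (FD : framing (sub_fib D) r)
    (eps : algebroid m E) (L : total_space E -> R)
    (d : total_space (sub_fib D)) :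
    tangent R (total_space (dual_fib (sub_fib D))) (k + r) :=
  let w := tulczyjew_diff A F eps L (tot_incl d) in
  let xi : total_space (@restr_fib R M (dual_fib E) S) :=
    existT (@restr_fib R M (dual_fib E) S) (tag d) (tagged (tag w)) in
  let AE := total_atlas A (dual_framing F) in
  let AES := total_atlas AS (restr_framing (dual_framing F) S) in
  let AD := total_atlas AS (dual_framing FD) in
  tmap AES AD (@dual_restr R M E S D)
    (tvec xi ((tlin AES AE (@dual_incl R M E S) xi)^-1%VF (tagged w))).

(* lambda_L^D = i_D^* o lambda_L restricted to D *)
Definition nh_legendre (R : realType) (M : Type) (m : nat)
    (A : atlas R M m) (E : M -> vectType R) (n : nat) (F : framing E n)
    (S : set M) (D : forall y : {x : M | S x}, {vspace E (sval y)})
    (eps : algebroid m E) (L : total_space E -> R)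
    (d : total_space (sub_fib D)) :
    total_space (dual_fib (sub_fib D)) :=
  dual_restr D (existT (@restr_fib R M (dual_fib E) S) (tag d)
    (tagged (legendre A F eps L (tot_incl d)))).

Definition nh_euler_lagrange (R : realType) (M : Type) (m : nat)
    (A : atlas R M m) (E : M -> vectType R) (n : nat) (F : framing E n)
    (S : set M) (k : nat) (AS : atlas R {x : M | S x} k)
    (D : forall y : {x : M | S x}, {vspace E (sval y)}) (r : nat)
    (FD : framing (sub_fib D) r)
    (eps : algebroid m E) (L : total_space E -> R) (I : set R)
    (gamma : R -> total_space (sub_fib D)) : Prop :=
  forall t, I t ->
    tprolong (total_atlas AS (dual_framing FD))
      (nh_legendre A F eps L \o gamma) t
    = nh_tulczyjew_diff A F AS FD eps L (gamma t).

(** * Nonholonomic restriction *)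

(* A smooth section of E extending the section [X] of D near [y]. *)
Definition extension (R : realType) (M : Type) (m : nat)
    (A : atlas R M m) (E : M -> vectType R) (n : nat) (F : framing E n)
    (S : set M) (k : nat) (AS : atlas R {x : M | S x} k)
    (D : forall y : {x : M | S x}, {vspace E (sval y)})
    (X : section (sub_fib D)) (y : {x : M | S x}) : section E :=
  pick_section (fun X' => smooth_section A F X' /\
    exists W, [/\ mopen AS W, W y &
      forall z, W z -> X' (sval z) = sub_incl D z (X z)]).

(* The anchors take values in the tangent bundle of [S] through the inverse of
   the (injective) tangent map of the inclusion of [S]; [daddv_pi U V] is the
   projection onto [U] along [V]. *)
Definition nh_restriction (R : realType) (M : Type) (m : nat)
    (A : atlas R M m) (E : M -> vectType R) (n : nat) (F : framing E n)
    (S : set M) (k : nat) (AS : atlas R {x : M | S x} k)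
    (D Dperp : forall y : {x : M | S x}, {vspace E (sval y)})
    (eps : algebroid m E) : algebroid k (sub_fib D) :=
  Algebroid
    (fun X Y y => vsproj (D y) (daddv_pi (D y) (Dperp y)
       (bracket eps (extension A F AS X y) (extension A F AS Y y) (sval y))))
    (fun y => ((tangent_incl A AS y)^-1 \o
               ((lanchor eps (sval y) : 'Hom(_, 'rV[R]_m))
                \o sub_incl D y))%VF)
    (fun y => ((tangent_incl A AS y)^-1 \o
               ((ranchor eps (sval y) : 'Hom(_, 'rV[R]_m))
                \o sub_incl D y))%VF).

(** * Metrics and mechanical Lagrangians *)

Definition is_bundle_metric (R : realType) (T : Type) (m : nat)
    (A : atlas R T m) (E : T -> vectType R) (n : nat) (F : framing E n)
    (G : forall x, E x -> E x -> R) : Prop :=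
  [/\ (forall x (c : R) u v w, G x (c *: u + v) w = c * G x u w + G x v w),
      (forall x u v, G x u v = G x v u),
      (forall x u, u != 0 -> 0 < G x u u) &
      (forall (s : fidx F) a b, smooth_fun A (V:=R^o) (fdom F s)
         (fun x => G x (tnth (frame F s x) a) (tnth (frame F s x) b)))].

Definition mechanical_lagrangian (R : realType) (T : Type)
    (E : T -> vectType R) (G : forall x, E x -> E x -> R) (V : T -> R)
    (e : total_space E) : R :=
  2^-1 * G (tag e) (tagged e) (tagged e) - V (tag e).

(* Main.v *)
Require Import Defs.
From HB Require Import structures.
From mathcomp Require Import all_boot all_order all_algebra.
From mathcomp Require Import all_classical all_reals all_analysis.
From mathcomp Require Import ring.
Import Order.TTheory GRing.Theory Num.Theory.
Import numFieldNormedType.Exports.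
Local Open Scope classical_set_scope.
Local Open Scope ring_scope.

(* Near a point of the submanifold choose a local frame [f_b] of D and extend it
   to smooth sections [X_b] of E, using slice charts and bump functions.  With
   [phi^c_b] the coordinates of [f_b] in a frame [e_c] of E, the Leibniz rule
   expresses [[X_a, X_b]] through the structure functions of E and the
   derivatives of [phi], which are derivatives along the submanifold because the
   anchors of sections of D are tangent to it.  At [e] in D the fibre derivative
   of L is the form [xi = G(e, .)], and [G(e, P w) = G(e, w)], so the projection
   P disappears when the structure functions of [eps_P] are contracted with the
   momenta of l.  The chain rule for [l = L o (D -> E)] gives
   [dl(v) = dL(v) + sum y^a xi_c d_v phi^c_a] for the base derivatives, and the
   extra term cancels the [sigma]-derivatives of [phi] in the bracket, while its
   [rho]-derivatives are exactly the term produced by the tangent map of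
   [i_D^*].  The Euler-Lagrange equations then agree because the Legendre map is
   the base point of the Tulczyjew differential. *)

Set Implicit Arguments.
Unset Strict Implicit.
Unset Printing Implicit Defensive.

(* MathComp-Analysis exports another [dlin]. *)
Local Notation dlin := Defs.dlin.

(** * Germs of smooth maps *)

(** Every point carries a preferred chart and frame, and tangent vectors are stored as components
    there. The comparison is therefore made at one point [d] of D at a time, in the preferred
    coordinates over its base point, and $\varepsilon$ never has to be rewritten in other
    coordinates. Only nearness and smoothness must be shown independent of the chart, since slice
    charts need not belong to the atlas.

    The bracket accepts global sections only, and local ones are globalized or extended by an
    unspecified choice that falls back to the zero section when there is no candidate. Bump
    functions supply the candidates. Of the chosen sections only smoothness and the prescribed germ
    are used: a germ on M for frames of E, a germ along the submanifold for frames of D.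

    The inverses of tangent maps in the definitions are [^-1%VF] of linear maps that need not be
    onto, so each use needs a reason: injectivity for the inclusion of the restricted dual bundle,
    membership in the image for the anchors. *)

Fixpoint Ck_near (R : realType) (V W : normedModType R) (k : nat) (f : V -> W)
    (p : V) : Prop :=
  match k with
  | 0%N => \forall x \near p, {for x, continuous f}
  | k'.+1 => (\forall x \near p, differentiable f x) /\
             forall v : V, Ck_near k' (fun x => 'D_v f x) p
  end.

(** The neighbourhood may shrink as the order grows, so closure under sums, products and composition
    needs no common open domain. Required at every point of an open set, the notion gives back
    [smooth_on] ([smooth_onP]). *)
Definition smooth_at (R : realType) (V W : normedModType R) (f : V -> W)
    (p : V) : Prop :=
  forall k, Ck_near k f p.

Section Smooth.
Variable R : realType.

Section Germs.
Variables V W : normedModType R.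
Implicit Types (f g : V -> W) (p x v : V).

(** ['d f p] is a chosen map, so the zero map is first shown to satisfy the expansion at p, and
    uniqueness identifies the two. Applied to g - f, this carries differentiability over to any
    function with the same germ. *)
Lemma differentiable_near0 f p :
  (\forall x \near p, f x = 0) -> differentiable f p.
Proof.
move=> f0; have fp0 : f p = 0 by exact: nbhs_singleton f0.
have o : f \o shift p = cst (f p) + (\0 : V -> W) +o_ 0 id.
  apply/eqaddoP => e e0; have := f0; rewrite (near_shift 0 p) subr0.
  apply: filterS => x /= fx.
  rewrite (_ : _ x = 0) ?normr0 ?mulr_ge0 ?(ltW e0) //.
  by change (f (x + p) - (f p + 0) = 0); rewrite fx fp0 addr0 subrr.
apply/diff_locallyP; have -> : 'd f p = \0 :> (V -> W).
  by apply: diff_unique o => ?; exact: cst_continuous.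
by split=> // ?; exact: cst_continuous.
Qed.

Lemma near_eq_differentiable f g p :
  (\forall x \near p, f x = g x) -> differentiable f p -> differentiable g p.
Proof.
move=> fg df; have -> : g = (fun x => f x + (g x - f x)).
  by apply/funext => x; rewrite addrC subrK.
apply: (@differentiableD _ _ _ f (fun x => g x - f x)) => //.
by apply: differentiable_near0; apply: filterS fg => x ->; rewrite subrr.
Qed.

Lemma near_eq_for_continuous f g p :
  (\forall x \near p, f x = g x) -> {for p, continuous f} ->
  {for p, continuous g}.
Proof.
move=> fg cf; rewrite /prop_for /continuous_at -(nbhs_singleton fg).
by apply: cvg_trans cf; apply: near_eq_cvg; apply: filterS fg => x ->.
Qed.

Lemma Ck_near_eq k f g p :
  (\forall x \near p, f x = g x) -> Ck_near k f p -> Ck_near k g p.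
Proof.
elim: k f g => [|k IHk] f g fg /=.
  (* Continuity at a nearby point depends on the germ there, so agreement near p is upgraded to
     agreement near every point close to p. *)
  move/near_join: fg => fg; apply: filterS2 fg => x.
  exact: near_eq_for_continuous.
move=> [df Df]; split=> [|v]; last first.
  apply: IHk (Df v); move/near_join: fg; apply: filterS => x.
  exact: near_eq_derive.
move/near_join: fg => fg; apply: filterS2 fg df => x.
exact: near_eq_differentiable.
Qed.

Lemma Ck_nearS k f p : Ck_near k.+1 f p -> Ck_near k f p.
Proof.
elim: k f => [|k IHk] f /= [df Df].
  by apply: filterS df => x; exact: differentiable_continuous.
by split=> // v; exact: IHk.
Qed.

Lemma Ck_near_cst k (w : W) p : Ck_near k (fun=> w) p.
Proof.
elim: k w => [|k IHk] w /=; first by near=> x; exact: cst_continuous.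
split=> [|v]; first by near=> x; exact: differentiable_cst.
by apply: Ck_near_eq (IHk 0); near=> x; rewrite (derive_cst w).
Unshelve. all: by end_near. Qed.

Lemma Ck_near_linear k (f : {linear V -> W}) p :
  continuous f -> Ck_near k f p.
Proof.
case: k => [|k] cf /=; first by near=> x; exact: cf.
split=> [|v]; first by near=> x; exact: linear_differentiable.
apply: Ck_near_eq (Ck_near_cst k (f v) p); near=> x.
by rewrite deriveE ?diff_lin //; exact: linear_differentiable.
Unshelve. all: by end_near. Qed.

Lemma Ck_near_add k f g p :
  Ck_near k f p -> Ck_near k g p -> Ck_near k (fun x => f x + g x) p.
Proof.
elim: k f g => [|k IHk] f g /=.
  by apply: filterS2 => x; exact: continuousD.
move=> [df Df] [dg Dg]; split=> [|v].
  by apply: filterS2 df dg => x; exact: differentiableD.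
apply: Ck_near_eq (IHk _ _ (Df v) (Dg v)).
apply: filterS2 df dg => x df dg; rewrite (@deriveD _ _ _ f g) //;
  exact: diff_derivable.
Qed.

Lemma Ck_near_sum k n (f : 'I_n -> V -> W) p :
  (forall i, Ck_near k (f i) p) -> Ck_near k (fun x => \sum_(i < n) f i x) p.
Proof.
elim: n f => [|n IHn] f fk.
  by apply: Ck_near_eq (Ck_near_cst k 0 p); near=> x; rewrite big_ord0.
apply: Ck_near_eq (Ck_near_add (IHn (fun i => f (widen_ord (leqnSn n) i)) _)
  (fk ord_max)) => [|i //].
by near=> x; rewrite big_ord_recr.
Unshelve. all: by end_near. Qed.

Lemma smooth_at_eq f g p :
  (\forall x \near p, f x = g x) -> smooth_at f p -> smooth_at g p.
Proof. by move=> fg fp k; apply: Ck_near_eq (fp k). Qed.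

Lemma smooth_at_near_continuous f p :
  smooth_at f p -> \forall x \near p, {for x, continuous f}.
Proof. by move=> /(_ 0%N). Qed.

Lemma smooth_at_near_differentiable f p :
  smooth_at f p -> \forall x \near p, differentiable f x.
Proof. by move=> /(_ 1%N) []. Qed.

Lemma smooth_at_differentiable f p : smooth_at f p -> differentiable f p.
Proof. by move=> /smooth_at_near_differentiable /nbhs_singleton. Qed.

Lemma Ck_at k (O : set V) f p : open O -> O p -> Ck k O f -> Ck_near k f p.
Proof.
move=> oO Op; have nO : \forall x \near p, O x by exact: open_nbhs_nbhs.
elim: k f => [|k IHk] f /=; first by move=> h; apply: filterS nO.
by move=> [h1 h2]; split=> [|v]; [apply: filterS nO|exact: IHk].
Qed.

Lemma Ck_of_near k (O : set V) f : (forall p, O p -> Ck_near k f p) -> Ck k O f.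
Proof.
elim: k f => [|k IHk] f /= h; first by move=> p /h /nbhs_singleton.
split=> [p /h [/nbhs_singleton]//|v]; apply: IHk => p /h [_]; exact.
Qed.

Lemma smooth_onP (O : set V) f :
  smooth_on O f <-> open O /\ forall p, O p -> smooth_at f p.
Proof.
split=> [] [oO h]; split=> //; first by move=> p Op k; exact: Ck_at (h k).
by move=> k; apply: Ck_of_near => p Op; exact: h.
Qed.

End Germs.

Lemma Ck_near_mul (V : normedModType R) k (f g : V -> R^o) p :
  Ck_near k f p -> Ck_near k g p -> Ck_near k (fun x => f x * g x : R^o) p.
Proof.
elim: k f g => [|k IHk] f g.
  by apply: filterS2 => x; exact: continuousM.
move=> fS gS; have [df Df] := fS; have [dg Dg] := gS; split=> [|v].
  by apply: filterS2 df dg => x; exact: differentiableM.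
apply: Ck_near_eq (Ck_near_add (IHk _ _ (Ck_nearS fS) (Dg v))
  (IHk _ _ (Ck_nearS gS) (Df v))).
apply: filterS2 df dg => x df dg; rewrite (@deriveM _ _ f g) //;
  exact: diff_derivable.
Qed.

Section RowVectors.
Variables (V : normedModType R) (n : nat).

Lemma linear_rV_continuous (W : normedModType R)
  (f : {linear 'rV[R]_n -> W}) : continuous f.
Proof.
move=> x; apply: differentiable_continuous.
have -> : (f : _ -> _) = \sum_(j < n) (fun u : 'rV[R]_n => u 0 j *: f (delta_mx 0 j)).
  apply/funext => u; rewrite fct_sumE {1}(row_sum_delta u) linear_sum.
  by apply: eq_bigr => j _; rewrite linearZ.
apply: differentiable_sum => j; apply: differentiableZl.
exact: differentiable_coord.
Qed.

Lemma row_sumE (f : V -> 'rV[R]_n) :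
  f = \sum_(j < n) (fun x => f x 0 j *: delta_mx 0 j).
Proof. by apply/funext => u; rewrite fct_sumE {1}(row_sum_delta (f u)). Qed.

Lemma differentiable_row (f : V -> 'rV[R]_n) p :
  (forall j, differentiable (fun x => f x 0 j : R^o) p) -> differentiable f p.
Proof.
move=> df; rewrite [f]row_sumE; apply: differentiable_sum => j.
by apply: differentiableZl; exact: df.
Qed.

Lemma differentiable_entry (f : V -> 'rV[R]_n) p j :
  differentiable f p -> differentiable (fun x => f x 0 j : R^o) p.
Proof.
move=> df; apply: (@differentiable_comp _ _ _ _ f
  (fun u : 'rV[R]_n => u 0 j : R^o)) => //; exact: differentiable_coord.
Qed.

Lemma derive_entry (f : V -> 'rV[R]_n) p v j : differentiable f p ->
  'D_v (fun x => f x 0 j : R^o) p = 'D_v f p 0 j.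
Proof. by move=> df; rewrite derive_mx ?mxE //; exact: diff_derivable. Qed.

Lemma continuous_row (f : V -> 'rV[R]_n) p :
  (forall j, {for p, continuous (fun x => f x 0 j : R^o)}) ->
  {for p, continuous f}.
Proof.
move=> cf.
have -> : f = fun x => \sum_(j < n) f x 0 j *: delta_mx 0 j.
  by apply/funext => x; exact: row_sum_delta.
apply: cvg_big => [|j _]; first exact: add_continuous.
by apply: cvgZr_tmp; exact: cf.
Qed.

Lemma Ck_near_row k (f : V -> 'rV[R]_n) p :
  (forall j, Ck_near k (fun x => f x 0 j : R^o) p) -> Ck_near k f p.
Proof.
elim: k f => [|k IHk] f fk /=.
  have {fk} : \forall x \near p, forall j, {for x, continuous (fun x => f x 0 j : R^o)}.
    by apply: filter_forall => j; exact: fk.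
  by apply: filterS => x cf; exact: continuous_row.
have df : \forall x \near p, differentiable f x.
  have : \forall x \near p, forall j, differentiable (fun x => f x 0 j : R^o) x.
    by apply: filter_forall => j; case: (fk j).
  by apply: filterS => x cf; exact: differentiable_row.
split=> // v; apply: IHk => j.
by apply: Ck_near_eq ((fk j).2 v); apply: filterS df => x; exact: derive_entry.
Qed.

Lemma Ck_near_entry k (f : V -> 'rV[R]_n) p j :
  Ck_near k f p -> Ck_near k (fun x => f x 0 j : R^o) p.
Proof.
elim: k f => [|k IHk] f /=.
  apply: filterS => x cf.
  apply: (@continuous_comp _ _ _ f (fun u : 'rV[R]_n => u 0 j : R^o)) cf _.
  exact: coord_continuous.
move=> [df Df]; split=> [|v].
  by apply: filterS df => x; exact: differentiable_entry.
apply: Ck_near_eq (IHk _ (Df v)).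
by apply: filterS df => x /derive_entry ->.
Qed.

Lemma diff_rV_sum (g : 'rV[R]_n -> R^o) p (u : 'rV[R]_n) :
  'd g p u = \sum_j u 0 j * 'd g p (delta_mx 0 j).
Proof.
rewrite {1}(row_sum_delta u) linear_sum; apply: eq_bigr => j _.
by rewrite linearZ.
Qed.

Lemma derive_comp_rV (f : V -> 'rV[R]_n) (g : 'rV[R]_n -> R^o) p v :
  differentiable f p -> differentiable g (f p) ->
  'D_v (g \o f) p = 'd g (f p) ('D_v f p).
Proof.
move=> df dg; rewrite deriveE; last exact: differentiable_comp.
by rewrite diff_comp // deriveE.
Qed.

(** By the chain rule D_v(g o f) is the sum over j of the j-th entry of D_v f times the j-th partial
    derivative of g composed with f. The induction hypothesis, stated for all g, applies to these
    partial derivatives. *)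
Lemma Ck_near_comp k (f : V -> 'rV[R]_n) (g : 'rV[R]_n -> R^o) p :
  Ck_near k f p -> Ck_near k g (f p) -> Ck_near k (g \o f) p.
Proof.
elim: k g => [|k IHk] g.
  move=> cf cg; have /(_ _ cg) : {for p, continuous f} := nbhs_singleton cf.
  by apply: filterS2 cf => x; exact: continuous_comp.
move=> fS gS; have [df Df] := fS; have [dg Dg] := gS.
have cf : {for p, continuous f}.
  exact: differentiable_continuous (nbhs_singleton df).
have dgf : \forall x \near p, differentiable g (f x) := cf _ dg.
split=> [|v]; first by apply: filterS2 df dgf => x; exact: differentiable_comp.
apply: Ck_near_eq (Ck_near_sum (fun j => Ck_near_mul
  (Ck_near_entry j (Df v)) (IHk _ (Ck_nearS fS) (Dg (delta_mx 0 j))))).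
apply: filterS2 df dgf => x dfx dgx.
rewrite derive_comp_rV // diff_rV_sum; apply: eq_bigr => j _.
by congr (_ * _); exact: deriveE.
Qed.

End RowVectors.

End Smooth.

(** * Smooth bump functions *)

Section SmoothAt.
Variables (R : realType) (V : normedModType R).
Implicit Types (f g : V -> R^o) (p : V).

Lemma smooth_at_cst (W : normedModType R) (w : W) p : smooth_at (fun=> w) p.
Proof. by move=> k; exact: Ck_near_cst. Qed.

Lemma smooth_at_add (W : normedModType R) (f g : V -> W) p :
  smooth_at f p -> smooth_at g p -> smooth_at (fun x => f x + g x) p.
Proof. by move=> fp gp k; exact: Ck_near_add. Qed.

Lemma smooth_at_sum (W : normedModType R) n (f : 'I_n -> V -> W) p :
  (forall i, smooth_at (f i) p) -> smooth_at (fun x => \sum_i f i x) p.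
Proof. by move=> fp k; apply: Ck_near_sum => i; exact: fp. Qed.

Lemma smooth_at_mul f g p :
  smooth_at f p -> smooth_at g p -> smooth_at (fun x => f x * g x : R^o) p.
Proof. by move=> fp gp k; exact: Ck_near_mul. Qed.

Lemma smooth_at_linear_rV n (W : normedModType R)
  (f : {linear 'rV[R]_n -> W}) (p : 'rV[R]_n) : smooth_at f p.
Proof. by move=> k; apply/Ck_near_linear/linear_rV_continuous. Qed.

Lemma smooth_at_row n (f : V -> 'rV[R]_n) p :
  (forall j, smooth_at (fun x => f x 0 j : R^o) p) -> smooth_at f p.
Proof. by move=> fp k; apply: Ck_near_row => j; exact: fp. Qed.

Lemma smooth_at_entry n (f : V -> 'rV[R]_n) p j :
  smooth_at f p -> smooth_at (fun x => f x 0 j : R^o) p.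
Proof. by move=> fp k; exact: Ck_near_entry. Qed.

Lemma smooth_at_comp n (f : V -> 'rV[R]_n) (g : 'rV[R]_n -> R^o) p :
  smooth_at f p -> smooth_at g (f p) -> smooth_at (g \o f) p.
Proof. by move=> fp gp k; exact: Ck_near_comp. Qed.

End SmoothAt.

Lemma smooth_at_comp_rV (R : realType) (V : normedModType R) n l
  (f : V -> 'rV[R]_n) (g : 'rV[R]_n -> 'rV[R]_l) p :
  smooth_at f p -> smooth_at g (f p) -> smooth_at (g \o f) p.
Proof.
move=> fp gp; apply: smooth_at_row => j.
exact: (smooth_at_comp fp (smooth_at_entry j gp)).
Qed.


Section Flat.
Variable R : realType.

(* The derivative of a member of this family is a linear combination of members,
   so the smoothness of all of them is proved by a single induction. *)
Definition flat (n : nat) (t : R) : R :=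
  if 0 < t then t^-1 ^+ n * expR (- t^-1) else 0.

Lemma flat_ge0 n t : 0 <= flat n t.
Proof.
rewrite /flat; case: ifPn => // t0.
by rewrite mulr_ge0 ?expR_ge0 // exprn_ge0 // invr_ge0 ltW.
Qed.

Lemma flat_le0 n t : t <= 0 -> flat n t = 0.
Proof. by move=> t0; rewrite /flat ltNge t0. Qed.

Lemma flat_gt0 n t : 0 < t -> 0 < flat n t.
Proof.
by move=> t0; rewrite /flat t0 mulr_gt0 ?expR_gt0 // exprn_gt0 // invr_gt0.
Qed.

Lemma flat0_ge t : 1 <= t -> flat 0 1 <= flat 0 t.
Proof.
move=> t1; have t0 : 0 < t by exact: lt_le_trans t1.
rewrite /flat ltr01 t0 !expr0 !mul1r invr1 ler_expR lerN2.
by rewrite invf_le1.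
Qed.

(** With s = 1/t this is e^s >= s^(n+2)/(n+2)!. The power 2 makes the difference quotient at 0 of
    order t, so the derivative there exists and vanishes. *)
Lemma flat_quadratic n t : flat n t <= n.+2`!%:R * t ^+ 2.
Proof.
have [t0|t0] := leP t 0; first by rewrite flat_le0 // mulr_ge0 ?sqr_ge0.
rewrite /flat t0; have [s s0 ->] : exists2 s, 0 < s & t = s^-1.
  by exists t^-1; rewrite ?invr_gt0 ?invrK.
have f0 : 0 < (n.+2)`!%:R :> R by rewrite ltr0n fact_gt0.
have h : s ^+ n.+2 / n.+2`!%:R <= expR s.
  apply: le_trans (expR_ge1Dxn n.+1 (ltW s0)); by rewrite lerDr.
rewrite invrK expRN exprVn ler_pdivrMr ?expR_gt0 // mulrAC.
rewrite ler_pdivlMr ?exprn_gt0 // -exprD addn2.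
by rewrite mulrC -ler_pdivrMr.
Qed.

Lemma is_derive_flat n (t : R) :
  is_derive t 1 (flat n) (flat n.+2 t - n%:R * flat n.+1 t).
Proof.
have [t0|t0|->] := ltgtP t 0.
- rewrite !flat_le0 ?ltW // mulr0 subrr.
  apply: (@near_eq_is_derive _ _ _ (cst 0 : R -> R^o)).
    near=> x; rewrite flat_le0 //; apply/ltW; near: x; exact: lt_nbhsl.
- apply: (@near_eq_is_derive _ _ _ (fun x : R => x^-1 ^+ n * expR (- x^-1) : R^o)).
    near=> x; rewrite /flat ifT //; near: x; exact: lt_nbhsr.
  have tN0 : t != 0 by rewrite gt_eqF.
  have di : is_derive t 1 (fun x : R => x^-1) (- t ^- 2).
    have := @is_deriveV R id t 1 1 tN0 (is_derive_id t (1 : R)).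
    by rewrite [_ *: _]mulr1.
  have de : is_derive t 1 (fun x : R => expR (- x^-1)) (expR (- t^-1) * t ^- 2).
    apply: (@is_derive1_comp R expR (fun x => - x^-1) t (expR (- t^-1)) (t ^- 2)).
    by rewrite -[t ^- 2]opprK; exact: is_deriveN.
  have dn : is_derive t 1 (fun x : R => x^-1 ^+ n) ((n%:R * t^-1 ^+ n.-1) * (- t ^- 2)).
    have := @is_deriveX _ _ (fun x : R => x^-1) n t 1 _ di.
    by rewrite exprfctE.
  apply: is_derive_eq (is_deriveM dn de) _.
  rewrite /flat t0 -exprVn.
  case: (n) => [|k] /=; rewrite /GRing.scale /= ?exprS ?expr0; set e := expR _; set i := t^-1; ring.
- rewrite !flat_le0 // mulr0 subrr.
  have h : h^-1 *: ((flat n \o shift 0) (h *: 1) - flat n 0) @[h --> 0^'] --> (0 : R).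
    apply/cvgrPdist_le => e e0; near=> h.
    rewrite sub0r normrN /= addr0 (flat_le0 n (lexx 0)) subr0 [_%:A]mulr1.
    have hN0 : h != 0 by near: h; exact: nbhs_dnbhs_neq.
    rewrite normrM normfV ler_pdivrMl ?normr_gt0 // ger0_norm ?flat_ge0 //.
    apply: le_trans (flat_quadratic n h) _.
    rewrite -real_normK ?num_real // expr2 mulrCA ler_wpM2l // mulrC.
    rewrite -ler_pdivlMr ?ltr0n ?fact_gt0 //.
    near: h; apply: dnbhs0_le; by rewrite divr_gt0 // ltr0n fact_gt0.
  by apply: DeriveDef; [apply/cvg_ex; exists 0|exact: cvg_lim h].
Unshelve. all: by end_near. Qed.

Lemma continuous_flat n : continuous (flat n : R^o -> R^o).
Proof.
move=> t; apply: differentiable_continuous; apply/derivable1_diffP.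
by have [] := is_derive_flat n t.
Qed.

Lemma Ck_near_flat (V : normedModType R) k n (f : V -> R^o) p :
  Ck_near k f p -> Ck_near k (fun x => flat n (f x) : R^o) p.
Proof.
elim: k n f => [|k IHk] n f.
  apply: filterS => x fx.
  by apply: (@continuous_comp _ _ _ f (flat n : R^o -> R^o)) => //; exact: continuous_flat.
move=> fS; have [df Df] := fS.
have dflat t : differentiable (flat n : R^o -> R^o) t.
  by apply/derivable1_diffP; have [] := is_derive_flat n t.
split=> [|v].
  apply: filterS df => x dfx.
  exact: (@differentiable_comp _ _ _ _ f (flat n : R^o -> R^o)).
apply: Ck_near_eq (Ck_near_mul (Df v) (Ck_near_add (IHk n.+2 _ (Ck_nearS fS))
  (Ck_near_mul (Ck_near_cst k (- n%:R : R^o) p) (IHk n.+1 _ (Ck_nearS fS))))).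
apply: filterS df => x dfx.
rewrite [RHS](_ : _ = 'd ((flat n : R^o -> R^o) \o f) x v); last first.
  apply: deriveE; exact: (@differentiable_comp _ _ _ _ f (flat n : R^o -> R^o)).
have [dn1 dn2] := is_derive_flat n (f x).
rewrite diff_comp // /= deriv1E // derive1E dn2 [in LHS]deriveE //.
by rewrite mulNr.
Qed.

(** The inner difference is the positive number [flat 0 1] for s <= 0 and is nonpositive for s >= 1,
    where the outer [flat] kills it. Unlike the usual cutoff f/(f+g), this one divides by a constant
    only, so sums, products and composition with [flat] suffice for its smoothness. *)
Definition step (s : R) : R := flat 0 (flat 0 1 - flat 0 s) / flat 0 (flat 0 1).

Lemma step_le0 s : s <= 0 -> step s = 1.
Proof.
move=> s0; rewrite /step (flat_le0 0 s0) subr0 divff // gt_eqF //.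
exact/flat_gt0/flat_gt0.
Qed.

Lemma step_ge1 s : 1 <= s -> step s = 0.
Proof.
by move=> s1; rewrite /step [flat 0 (_ - _)]flat_le0 ?mul0r // subr_le0 flat0_ge.
Qed.

Lemma smooth_at_step (V : normedModType R) (f : V -> R^o) p :
  smooth_at f p -> smooth_at (fun x => step (f x) : R^o) p.
Proof.
move=> fp; apply: smooth_at_mul; last exact: smooth_at_cst.
move=> k; apply: Ck_near_flat.
apply: smooth_at_add; first exact: smooth_at_cst.
apply: (@smooth_at_eq _ _ _ (fun x => (-1) * flat 0 (f x) : R^o)).
  by near=> x; rewrite mulN1r.
apply: smooth_at_mul; first exact: smooth_at_cst.
by move=> l; exact: Ck_near_flat.
Unshelve. all: by end_near. Qed.

Lemma rV_bump m (p : 'rV[R]_m) (O : set 'rV[R]_m) : nbhs p O ->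
  exists (b : 'rV[R]_m -> R^o) (K : set 'rV[R]_m),
  [/\ compact K, K `<=` O, forall u, smooth_at b u,
      \forall u \near p, b u = 1 & forall u, ~ K u -> b u = 0].
Proof.
move=> /nbhs_ballP [e /= e0 eO].
(* The norm of row vectors is the maximum norm, which is not smooth, so the bump is built on a sum
   of squares. Outside the closed ball of radius e/2 some coordinate differs from that of p by more
   than e/2, whence [q] exceeds [c]. *)
pose q (u : 'rV[R]_m) : R^o := \sum_i (u 0 i - p 0 i) ^+ 2.
pose c := (e / 2) ^+ 2; have c0 : 0 < c by rewrite exprn_gt0 // divr_gt0.
have qs u : smooth_at q u.
  apply: smooth_at_sum => i.
  have s : smooth_at (fun u : 'rV[R]_m => u 0 i - p 0 i : R^o) u.
    apply: smooth_at_add; last exact: smooth_at_cst.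
    apply: (@smooth_at_entry _ _ _ (idfun : {linear 'rV[R]_m -> 'rV[R]_m})).
    exact: smooth_at_linear_rV.
  exact: smooth_at_mul.
(* The argument of [step] is at most 0 where q <= c/2 and at least 1 where q >= c. *)
exists (fun u => step (2 / c * q u - 1)), (closed_ball_ Num.norm p (e / 2)); split.
- apply: bounded_closed_compact; last exact: closed_closed_ball_.
  exists (`|p| + e / 2); split; first exact: num_real.
  move=> M /ltW hM u /= ue; apply: le_trans hM.
  rewrite -[u](subrK p) addrC; apply: le_trans (ler_normD _ _) _.
  by rewrite lerD2l distrC.
- move=> u /= ue; apply: eO; rewrite -ball_normE /ball_ /=.
  by apply: le_lt_trans ue _; rewrite ltr_pdivrMr // ltr_pMr // ltr1n.
- move=> u; apply: smooth_at_step; apply: smooth_at_add; last exact: smooth_at_cst.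
  by apply: smooth_at_mul => //; exact: smooth_at_cst.
- have qp : q p = 0 by rewrite /q big1 // => i _; rewrite subrr expr0n.
  have : \forall u \near p, q u < c / 2.
    have cq : {for p, continuous q} by exact: nbhs_singleton (smooth_at_near_continuous (qs p)).
    apply: (cvgr_lt _ cq); by rewrite qp divr_gt0.
  apply: filterS => u qu; apply: step_le0.
  rewrite subr_le0 -ler_pdivlMl ?divr_gt0 // mulr1 invf_div; exact: ltW.
- move=> u /negP /=; rewrite -ltNge => ue; apply: step_ge1.
  have [i ci] : exists i, c < (u 0 i - p 0 i) ^+ 2.
    apply/not_existsP => h; move: ue; apply/negP; rewrite -leNgt.
    rewrite /Num.Def.normr /= mx_normrE; apply: bigmax_le => [|[i j] _ /=].
      by rewrite divr_ge0 // ltW.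
    rewrite (ord1 i) !mxE distrC -(@ler_pXn2r _ 2) ?nnegrE // ?divr_ge0 ?(ltW e0) //.
    by rewrite real_normK ?num_real // leNgt; apply/negP/h.
  have cq : c <= q u.
    rewrite /q (bigD1 i) //= ler_wpDr ?(ltW ci) //.
    by apply: sumr_ge0 => k _; exact: sqr_ge0.
  by rewrite lerBrDr mulrAC ler_pdivlMr // -[1 + 1]/(2 : R) ler_pM2l.
Unshelve. all: by end_near. Qed.

End Flat.

(** * Manifolds and sections of vector bundles *)

Section Charts.
Variables (R : realType) (T : Type) (m : nat).
Implicit Types (c : chart R T m) (x : T) (P : T -> Prop).

Lemma chart_compat_sym c c' : chart_compat c c' -> chart_compat c' c.
Proof. by move=> [h1 h2]; split; rewrite setIC. Qed.

Lemma chart_inv_near c x : is_chart c -> cdom c x ->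
  \forall u \near cmap c x, cdom c (cinv c u) /\ cmap c (cinv c u) = u.
Proof.
move=> [oc ck] cx; have : \forall u \near cmap c x, (cmap c @` cdom c) u.
  by apply: open_nbhs_nbhs; split=> //; exists x.
by apply: filterS => _ [y cy <-]; rewrite ck.
Qed.

Lemma cmapK c x : is_chart c -> cdom c x -> cinv c (cmap c x) = x.
Proof. by move=> [_]; exact. Qed.

Lemma transition_smooth c c' x : chart_compat c c' -> cdom c x ->
  cdom c' x -> smooth_at (cmap c' \o cinv c) (cmap c x).
Proof.
by move=> [/smooth_onP[_ h] _] cx cx'; apply: h; exists x.
Qed.

(** The transition map is continuous at the point and the overlap has open image, so properties
    holding near the point pass from one chart to the other. This is what makes [mnbhs] independent
    of the chart. *)
Lemma near_chart c c' x P : is_chart c -> is_chart c' -> chart_compat c c' ->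
  cdom c x -> cdom c' x ->
  (\forall u \near cmap c' x, P (cinv c' u)) ->
  \forall u \near cmap c x, P (cinv c u).
Proof.
move=> hc hc' cc' cx cx' hP.
have /smooth_at_near_continuous/nbhs_singleton cont := transition_smooth cc' cx cx'.
have nP : \forall u \near cmap c x, P (cinv c' (cmap c' (cinv c u))).
  by apply: (cont (fun u => P (cinv c' u))); rewrite /= hc.2.
have nd : \forall u \near cmap c x, (cmap c @` (cdom c `&` cdom c')) u.
  by apply: open_nbhs_nbhs; split; [case: cc' => [[]]|exists x].
apply: filterS2 nd nP => _ [y [cy c'y] <-]; by rewrite hc.2 // hc'.2.
Qed.

End Charts.

(** The neighbourhood filter of the topology determined by the atlas; [T] thus needs no topological
    structure of its own for filter reasoning. *)
Definition mnbhs (R : realType) (T : Type) (m : nat) (A : atlas R T m)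
    (x : T) : set_system T :=
  cinv (chart_at A x) @ nbhs (cmap (chart_at A x) x).

Lemma mnbhsE (R : realType) (T : Type) (m : nat) (A : atlas R T m) x P :
  mnbhs A x P = \forall u \near cmap (chart_at A x) x, P (cinv (chart_at A x) u).
Proof. by []. Qed.

(** Membership in the maximal atlas, which is all that is known of slice charts. *)
Definition compatible (R : realType) (T : Type) (m : nat) (A : atlas R T m)
    (c : chart R T m) : Prop :=
  is_chart c /\ forall i, chart_compat c (achart A i).

Definition msmooth (R : realType) (T : Type) (m : nat) (A : atlas R T m)
    (f : T -> R) (x : T) : Prop :=
  smooth_at (f \o cinv (chart_at A x) : 'rV[R]_m -> R^o) (cmap (chart_at A x) x).

Section Manifold.
Variables (R : realType) (T : Type) (m : nat) (A : atlas R T m).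
Hypothesis hA : is_manifold A.
Implicit Types (c : chart R T m) (x : T) (P W : set T) (f g : T -> R).

Lemma compatible_achart i : compatible A (achart A i).
Proof. by case: hA => -[h1 h2] _ _ _; split. Qed.

Lemma compatible_chart_at x : compatible A (chart_at A x).
Proof. exact: compatible_achart. Qed.

Lemma cdom_chart_at x : cdom (chart_at A x) x.
Proof. by case: hA. Qed.

#[local] Instance mnbhs_filter x : ProperFilter (mnbhs A x).
Proof. exact: fmap_proper_filter. Qed.

Lemma mnbhsP c x P : compatible A c -> cdom c x ->
  mnbhs A x P <-> \forall u \near cmap c x, P (cinv c u).
Proof.
move=> [hc cc] cx; have [hi _] := compatible_achart (apref A x).
have c0x := cdom_chart_at x; have cc0 := cc (apref A x).
by split; apply: near_chart => //; exact: chart_compat_sym.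
Qed.

Lemma mnbhs_singleton x P : mnbhs A x P -> P x.
Proof.
move=> /nbhs_singleton.
by rewrite /= (cmapK (compatible_chart_at x).1 (cdom_chart_at x)).
Qed.

Lemma cdom_mnbhs c x : compatible A c -> cdom c x -> mnbhs A x (cdom c).
Proof.
move=> hc cx; apply/(mnbhsP _ hc cx).
by apply: filterS (chart_inv_near hc.1 cx) => u [].
Qed.

Lemma mopenP W : mopen A W <-> forall x, W x -> mnbhs A x W.
Proof.
split=> [oW x Wx|h i].
  have cx := cdom_chart_at x; apply/(mnbhsP _ (compatible_achart (apref A x)) cx).
  have : \forall u \near cmap (achart A (apref A x)) x,
    (cmap (achart A (apref A x)) @` (cdom (achart A (apref A x)) `&` W)) u.
    by apply: open_nbhs_nbhs; split; [exact: oW|exists x].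
  apply: filterS => _ [y [cy Wy] <-].
  by rewrite (cmapK (compatible_achart (apref A x)).1 cy).
rewrite openE => _ [x [cx Wx] <-]; rewrite /interior.
have /(mnbhsP _ (compatible_achart i) cx) h1 := h x Wx.
apply: filterS2 h1 (chart_inv_near (compatible_achart i).1 cx) => u Wu [du eu].
by exists (cinv (achart A i) u).
Qed.

Lemma mnbhs_mopen x P : mnbhs A x P -> exists W, [/\ mopen A W, W x & W `<=` P].
Proof.
move=> xP; set c := chart_at A x; have [hc cc] : compatible A c by exact: compatible_chart_at.
pose O := [set u | cdom c (cinv c u) /\ cmap c (cinv c u) = u /\ P (cinv c u)]^°.
have xO : nbhs (cmap c x) O.
  apply: nbhs_interior.
  by apply: filterS2 (chart_inv_near hc (cdom_chart_at x)) xP => u [].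
exists [set z | cdom c z /\ O (cmap c z)]; split.
- apply/mopenP => z [cz Oz]; apply/(mnbhsP _ (conj hc cc) cz).
  have := open_interior [set u | cdom c (cinv c u) /\ cmap c (cinv c u) = u /\ P (cinv c u)].
  rewrite openE => /(_ _ Oz); apply: filterS => u Ou.
  have [h1 [h2 h3]] : cdom c (cinv c u) /\ cmap c (cinv c u) = u /\ P (cinv c u).
    exact: interior_subset Ou.
  split; [exact: h1|rewrite h2; exact: Ou].
- by split; [exact: cdom_chart_at|exact: nbhs_singleton xO].
- by move=> z [cz /interior_subset [_ [_]]]; rewrite hc.2.
Qed.

Lemma msmoothP c x f : compatible A c -> cdom c x ->
  msmooth A f x <-> smooth_at (f \o cinv c : 'rV[R]_m -> R^o) (cmap c x).
Proof.
have key c1 c2 : is_chart c1 -> is_chart c2 -> chart_compat c1 c2 ->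
    cdom c1 x -> cdom c2 x ->
    smooth_at (f \o cinv c1 : 'rV[R]_m -> R^o) (cmap c1 x) ->
    smooth_at (f \o cinv c2 : 'rV[R]_m -> R^o) (cmap c2 x).
  move=> h1 h2 h12 c1x c2x hf.
  apply: (@smooth_at_eq _ _ _ ((f \o cinv c1 : 'rV[R]_m -> R^o) \o (cmap c1 \o cinv c2))).
    have c1n : \forall u \near cmap c1 x, cdom c1 (cinv c1 u).
      by apply: filterS (chart_inv_near h1 c1x) => u [].
    have := near_chart h2 h1 (chart_compat_sym h12) c2x c1x c1n.
    by apply: filterS => u /= hu; rewrite h1.2.
  apply: smooth_at_comp; last by rewrite /= h2.2.
  by apply: transition_smooth => //; exact: chart_compat_sym.
move=> [hc cc] cx; have [hi _] := compatible_achart (apref A x).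
have c0x := cdom_chart_at x; have cc0 := cc (apref A x).
by split; apply: key => //; exact: chart_compat_sym.
Qed.

Lemma msmooth_near f g x :
  mnbhs A x [set z | f z = g z] -> msmooth A f x -> msmooth A g x.
Proof. by move=> fg; apply: smooth_at_eq. Qed.

Lemma msmooth_cst (k : R) x : msmooth A (fun=> k) x.
Proof. exact: smooth_at_cst. Qed.

Lemma msmoothD f g x :
  msmooth A f x -> msmooth A g x -> msmooth A (fun z => f z + g z) x.
Proof. exact: smooth_at_add. Qed.

Lemma msmoothM f g x :
  msmooth A f x -> msmooth A g x -> msmooth A (fun z => f z * g z) x.
Proof. exact: smooth_at_mul. Qed.

Lemma msmooth_sum n (f : 'I_n -> T -> R) x :
  (forall i, msmooth A (f i) x) -> msmooth A (fun z => \sum_i f i z) x.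
Proof. exact: smooth_at_sum. Qed.

Lemma msmooth_chart c x (g : 'rV[R]_m -> R^o) : compatible A c -> cdom c x ->
  smooth_at g (cmap c x) -> msmooth A (g \o cmap c) x.
Proof.
move=> hc cx; move=> hg; apply/(msmoothP _ hc cx); apply: smooth_at_eq hg.
by apply: filterS (chart_inv_near hc.1 cx) => u [_ /= ->].
Qed.

Lemma smooth_funP W f : smooth_fun A (V:=R^o) W f <->
  mopen A W /\ forall x, W x -> msmooth A f x.
Proof.
split=> [h|[oW h] i].
  split=> [i|x Wx]; first by have /smooth_onP[] := h i.
  have /smooth_onP[_] := h (apref A x); apply.
  by exists x => //; split=> //; exact: cdom_chart_at.
apply/smooth_onP; split=> [|_ [x [cx Wx] <-]]; first exact: oW.
by apply/(msmoothP _ (compatible_achart i) cx); exact: h.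
Qed.

(** The last clause is shaped for extension by zero: at each point either a local object given on
    [W] is available, or its product with [b] vanishes on a whole neighbourhood. *)
Lemma manifold_bump x W : mnbhs A x W ->
  exists b : T -> R, [/\ forall z, msmooth A b z, mnbhs A x [set z | b z = 1] &
    forall z, W z \/ mnbhs A z [set w | b w = 0]].
Proof.
move=> xW; set c := chart_at A x; have hc : compatible A c by exact: compatible_chart_at.
have cx : cdom c x by exact: cdom_chart_at.
have xO : \forall u \near cmap c x, cdom c (cinv c u) /\
    cmap c (cinv c u) = u /\ W (cinv c u).
  by apply: filterS2 (chart_inv_near hc.1 cx) xW => u [].
have [b0 [K [cK KO b0s b01 b00]]] := rV_bump xO.
pose b z := if pselect (cdom c z) then b0 (cmap c z) else 0.
have bE z : cdom c z -> b z = b0 (cmap c z) by rewrite /b; case: pselect.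
(* The compact set [cinv c @` K] is closed because the manifold is Hausdorff. *)
have off z : ~ (cinv c @` K) z -> mnbhs A z [set w | b w = 0].
  move=> Kz.
  have nearK : \forall w \near mnbhs A z, K `<=` [set u | cinv c u <> w].
    move/compact_near_coveringP: cK; apply.
    move=> u Ku; have [cu [uE _]] := KO _ Ku.
    have [|U [W' [[oU oW'] Uy W'z UW']]] := let: And4 _ _ h _ := hA in h (cinv c u) z.
      by move=> e; apply: Kz; exists u.
    exists ([set v | U (cinv c v)], W') => /=; last first.
      move=> [v w] [/= Uv Ww] e; suff : (U `&` W') w by rewrite UW'.
      by split=> //; rewrite -e.
    split; last by move/mopenP: oW'; exact.
    by rewrite -uE; apply/(mnbhsP _ hc cu); move/mopenP: oU; exact.
  apply: filterS nearK => w Kw; rewrite /= /b; case: pselect => // cw.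
  by apply: b00 => /Kw /=; rewrite (cmapK hc.1 cw).
exists b; split=> [z||z].
- have [[u Ku <-]|/off zb] := pselect ((cinv c @` K) z).
    have [cu _] := KO _ Ku.
    apply: msmooth_near (msmooth_chart hc cu (b0s _)).
    by apply: filterS (cdom_mnbhs hc cu) => w /bE.
  by apply: msmooth_near (msmooth_cst 0 z); apply: filterS zb => w /= ->.
- apply/(mnbhsP _ hc cx); apply: filterS2 b01 (chart_inv_near hc.1 cx).
  by move=> u h [/bE h1 h2] /=; rewrite h1 h2.
- have [[u Ku <-]|/off] := pselect ((cinv c @` K) z); last by right.
  by left; have [_ [_]] := KO _ Ku.
Qed.

End Manifold.

Section Sections.
Variables (R : realType) (T : Type) (m : nat) (A : atlas R T m).
Hypothesis hA : is_manifold A.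
Variables (n : nat) (E : T -> vectType R) (F : framing E n).
Hypothesis hE : is_vbundle A F.
Implicit Types (X Y : section E) (x : T) (s : fidx F).

Definition smooth_section_at X x : Prop :=
  forall s a, fdom F s x -> msmooth A (fun z => fcoord F s a (X z)) x.

Lemma fdom_mnbhs s x : fdom F s x -> mnbhs A x (fdom F s).
Proof. by case: hE => _ /(_ s) /(mopenP hA) h _ _ /h. Qed.

Lemma fdom_pref x : fdom F (fpref F x) x.
Proof. by case: hE. Qed.

Lemma frame_basis s x : fdom F s x -> basis_of fullv (frame F s x).
Proof. by case: hE => _ _ h _; exact: h. Qed.

Lemma fcoord_sum s x (v : E x) : fdom F s x ->
  v = \sum_a fcoord F s a v *: tnth (frame F s x) a.
Proof.
move=> sx; rewrite {1}(coord_basis (frame_basis sx) (memvf v)).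
by apply: eq_bigr => a _; rewrite (tnth_nth 0).
Qed.

Lemma fcoord_frame s x a b : fdom F s x ->
  fcoord F s a (tnth (frame F s x) b) = (a == b)%:R.
Proof.
move=> sx; rewrite /fcoord (tnth_nth 0) coord_free 1?eq_sym //.
by have /andP[] := frame_basis sx.
Qed.

Lemma smooth_section_atP X :
  smooth_section A F X <-> forall x, smooth_section_at X x.
Proof.
split=> [h x s a sx|h s a].
  by have /(smooth_funP hA) [_] := h s a; exact.
apply/(smooth_funP hA); split=> [|x sx]; last exact: h.
by case: hE.
Qed.

Lemma smooth_section_at_frame s a x : fdom F s x ->
  smooth_section_at (fun z => tnth (frame F s z) a) x.
Proof.
move=> sx s' b s'x; case: hE => _ _ _ /(_ s' s b a) /(smooth_funP hA) [_].
exact.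
Qed.

Lemma smooth_section_at_near X Y x :
  mnbhs A x [set z | X z = Y z] -> smooth_section_at X x -> smooth_section_at Y x.
Proof.
move=> XY h s a sx; apply: msmooth_near (h s a sx).
by apply: filterS XY => z /= ->.
Qed.

Lemma smooth_section_at_scale (f : T -> R) X x : msmooth A f x ->
  smooth_section_at X x -> smooth_section_at (fun z => f z *: X z) x.
Proof.
move=> fx h s a sx; apply: msmooth_near (msmoothM fx (h s a sx)).
by apply: filterE => z; rewrite /= /fcoord linearZ.
Qed.

Lemma smooth_section_at_add X Y x : smooth_section_at X x ->
  smooth_section_at Y x -> smooth_section_at (fun z => X z + Y z) x.
Proof.
move=> hX hY s a sx; apply: msmooth_near (msmoothD (hX s a sx) (hY s a sx)).
by apply: filterE => z; rewrite /= /fcoord linearD.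
Qed.

Lemma smooth_section_at0 x : smooth_section_at (fun=> 0) x.
Proof.
move=> s a sx; apply: msmooth_near (msmooth_cst A 0 x).
by apply: filterE => z; rewrite /= /fcoord linear0.
Qed.

Lemma smooth_section_at_sum k (X : 'I_k -> section E) x :
  (forall i, smooth_section_at (X i) x) ->
  smooth_section_at (fun z => \sum_i X i z) x.
Proof.
elim: k X => [|k IHk] X h.
  apply: (smooth_section_at_near (X := fun=> 0)); last exact: smooth_section_at0.
  by apply: filterE => z; rewrite /= big_ord0.
apply: (smooth_section_at_near
  (X := fun z => \sum_i X (widen_ord (leqnSn k) i) z + X ord_max z)).
  by apply: filterE => z; rewrite /= big_ord_recr.
by apply: smooth_section_at_add; [apply: IHk => i; exact: h|exact: h].
Qed.

Lemma section_germ_extends X x :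
  mnbhs A x (smooth_section_at X) ->
  exists X', smooth_section A F X' /\
    exists W, [/\ mopen A W, W x & forall z, W z -> X' z = X z].
Proof.
move=> /(manifold_bump hA) [b [bs b1 b0]].
exists (fun z => b z *: X z); split.
  apply/smooth_section_atP => z; have [Xz|bz] := b0 z.
    exact: smooth_section_at_scale.
  apply: (smooth_section_at_near (X := fun=> 0)); last exact: smooth_section_at0.
  by apply: filterS bz => w /= ->; rewrite scale0r.
have [W [oW Wx h]] := mnbhs_mopen hA b1.
by exists W; split=> // z /h /= ->; rewrite scale1r.
Qed.

Lemma pick_sectionP (Q : section E -> Prop) :
  (exists X, Q X) -> Q (pick_section Q).
Proof. by move=> h; rewrite /pick_section; case: pselect => // h'; case: (cid h'). Qed.

Lemma globalizeP X x : mnbhs A x (smooth_section_at X) ->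
  smooth_section A F (globalize A F X x) /\
  mnbhs A x [set z | globalize A F X x z = X z].
Proof.
move=> /section_germ_extends /pick_sectionP [h [W [oW Wx hW]]]; split=> //.
by have /(mopenP hA)/(_ x Wx) := oW; exact: filterS.
Qed.

End Sections.

(** * The bracket in a local frame *)

Section Bracket.
Variables (R : realType) (T : Type) (m : nat) (A : atlas R T m).
Hypothesis hA : is_manifold A.
Variables (n : nat) (E : T -> vectType R) (F : framing E n).
Hypothesis hE : is_vbundle A F.
Variable eps : algebroid m E.
Hypothesis heps : is_algebroid A F eps.
Implicit Types (X Y : section E) (x : T) (s : fidx F) (f g : T -> R).

#[local] Existing Instance mnbhs_filter.

Lemma section_ext X Y : (forall z, X z = Y z) -> X = Y.
Proof. exact: functional_extensionality_dep. Qed.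

Lemma near_eq_diff (V W : normedModType R) (f g : V -> W) p :
  differentiable f p -> (\forall u \near p, f u = g u) ->
  'd f p = 'd g p :> (V -> W).
Proof.
move=> df fg; apply/funext => v; rewrite -!deriveE //.
  exact: near_eq_derive.
exact: near_eq_differentiable df.
Qed.

Lemma dlinE f x v : dlin A f x v =
  'd (f \o cinv (chart_at A x) : 'rV[R]_m -> R^o) (cmap (chart_at A x) x) v.
Proof. by rewrite /dlin lfunE. Qed.

Lemma dlin_near f g x : msmooth A f x -> mnbhs A x [set z | f z = g z] ->
  dlin A f x = dlin A g x.
Proof.
by move=> fx fg; rewrite /dlin (near_eq_diff (smooth_at_differentiable fx) fg).
Qed.

Lemma dlin_const f (k : R) x v : mnbhs A x [set z | f z = k] -> dlin A f x v = 0.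
Proof.
move=> fk; rewrite -(@dlin_near (fun=> k)) ?dlinE.
- by rewrite [_ \o _](_ : _ = cst k) // diff_cst.
- exact: msmooth_cst.
- by apply: filterS fk => z /= ->.
Qed.

Lemma smooth_fun_setT f :
  (forall x, msmooth A f x) -> smooth_fun A (V:=R^o) setT f.
Proof.
by move=> h; apply/(smooth_funP hA); split=> // ; apply/(mopenP hA) => x _; exact: filterT.
Qed.

Lemma smooth_section_scale f X : (forall x, msmooth A f x) ->
  smooth_section A F X -> smooth_section A F (fun z => f z *: X z).
Proof.
move=> fs /(smooth_section_atP hA hE) Xs; apply/(smooth_section_atP hA hE) => x.
exact: smooth_section_at_scale.
Qed.

Lemma smooth_section0 : smooth_section A F (fun=> 0).
Proof. by apply/(smooth_section_atP hA hE) => x; exact: smooth_section_at0. Qed.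

Lemma smooth_section_sum k (X : 'I_k -> section E) :
  (forall i, smooth_section A F (X i)) ->
  smooth_section A F (fun z => \sum_i X i z).
Proof.
move=> h; apply/(smooth_section_atP hA hE) => x.
by apply: smooth_section_at_sum => i; move: x; exact/(smooth_section_atP hA hE).
Qed.

Lemma bracket_suml k (X : 'I_k -> section E) Y x :
  (forall i, smooth_section A F (X i)) -> smooth_section A F Y ->
  bracket eps (fun z => \sum_i X i z) Y x = \sum_i bracket eps (X i) Y x.
Proof.
move=> hX hY; case: heps => _ _ hl _ _.
elim: k X hX => [|k IHk] X hX.
  (* Both summands zero and the scalar -1 in the linearity axiom give br(0, Y) = - br(0, Y) + br(0,
     Y) = 0. *)
  have /= := hl (-1) (fun=> 0) (fun=> 0) Y smooth_section0 smooth_section0 hY x.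
  rewrite scaleN1r addNr big_ord0 => h; rewrite -[RHS]h.
  rewrite (@section_ext (fun z => -1 *: 0 + 0) (fun z => \sum_(i < 0) X i z)) // => z.
  by rewrite big_ord0 scaleN1r addNr.
rewrite big_ord_recr /= -IHk => [|i]; last exact: hX.
have hS : smooth_section A F (fun z => \sum_i X (widen_ord (leqnSn k) i) z).
  by apply: smooth_section_sum => i; exact: hX.
have := hl 1 _ _ Y (hX ord_max) hS hY x; rewrite scale1r addrC => <-.
rewrite (@section_ext (fun z => \sum_(i < k.+1) X i z) (fun z => 1 *: X ord_max z
  + \sum_(i < k) X (widen_ord (leqnSn k) i) z)) // => z.
by rewrite big_ord_recr /= scale1r addrC.
Qed.

Lemma bracket_sumr k X (Y : 'I_k -> section E) x :
  smooth_section A F X -> (forall i, smooth_section A F (Y i)) ->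
  bracket eps X (fun z => \sum_i Y i z) x = \sum_i bracket eps X (Y i) x.
Proof.
move=> hX hY; case: heps => _ _ _ hl _.
elim: k Y hY => [|k IHk] Y hY.
  have /= := hl (-1) X (fun=> 0) (fun=> 0) hX smooth_section0 smooth_section0 x.
  rewrite scaleN1r addNr big_ord0 => h; rewrite -[RHS]h.
  rewrite (@section_ext (fun z => -1 *: 0 + 0) (fun z => \sum_(i < 0) Y i z)) // => z.
  by rewrite big_ord0 scaleN1r addNr.
rewrite big_ord_recr /= -IHk => [|i]; last exact: hY.
have hS : smooth_section A F (fun z => \sum_i Y (widen_ord (leqnSn k) i) z).
  by apply: smooth_section_sum => i; exact: hY.
have := hl 1 X _ _ hX (hY ord_max) hS x; rewrite scale1r addrC => <-.
rewrite (@section_ext (fun z => \sum_(i < k.+1) Y i z) (fun z => 1 *: Y ord_max z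
  + \sum_(i < k) Y (widen_ord (leqnSn k) i) z)) // => z.
by rewrite big_ord_recr /= scale1r addrC.
Qed.

(* Multiplying by a bump function makes the local expansion of a section in the
   frame global without changing the bracket at [x]. *)
Lemma bracket_frame X Y x s (e : 'I_n -> section E) :
  smooth_section A F X -> smooth_section A F Y -> fdom F s x ->
  (forall c, smooth_section A F (e c)) ->
  mnbhs A x [set z | forall c, e c z = tnth (frame F s z) c] ->
  bracket eps X Y x =
    \sum_d dlin A (fun z => fcoord F s d (Y z)) x (lanchor eps x (X x)) *: e d x
    - \sum_c dlin A (fun z => fcoord F s c (X z)) x (ranchor eps x (Y x)) *: e c x
    + \sum_c \sum_d (fcoord F s c (X x) * fcoord F s d (Y x)) *:
        bracket eps (e c) (e d) x.
Proof.
move=> hX hY sx he eE; case: heps => _ _ _ _ leib.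
have [b [bs b1 b0]] := manifold_bump hA (filterI (fdom_mnbhs hA hE sx) eE).
have bx : b x = 1 by exact: mnbhs_singleton b1.
have bsm := smooth_fun_setT bs.
have coordS Z : smooth_section A F Z -> forall c z,
    msmooth A (fun z => b z * fcoord F s c (Z z)) z.
  move=> /(smooth_section_atP hA hE) Zs c z; have [[sz _]|bz] := b0 z.
    by apply: msmoothM => //; exact: Zs.
  apply: msmooth_near (msmooth_cst A 0 z).
  by apply: filterS bz => w /= ->; rewrite mul0r.
have expand Z : (fun z => b z *: Z z) =
    fun z => \sum_c (b z * fcoord F s c (Z z)) *: e c z.
  apply: section_ext => z; have [[sz ez]|bz] := b0 z.
    rewrite {1}(fcoord_sum hE (Z z) sz) scaler_sumr.
    by apply: eq_bigr => c _; rewrite scalerA ez.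
  rewrite (mnbhs_singleton hA bz) scale0r big1 // => c _.
  by rewrite mul0r scale0r.
(* Since [b] is 1 near x, its differential vanishes at x and both anchor terms of the Leibniz rule
   drop out. *)
have <- : bracket eps (fun z => b z *: X z) (fun z => b z *: Y z) x = bracket eps X Y x.
  by rewrite leib // !(dlin_const _ b1) bx !mulr0 !scale0r subrr add0r mulr1 scale1r.
rewrite !expand bracket_suml; last 2 first.
- by move=> c; apply: smooth_section_scale => // z; exact: coordS.
- apply: smooth_section_sum => c.
  by apply: smooth_section_scale => // z; exact: coordS.
have dcoord Z : smooth_section A F Z -> forall c,
    dlin A (fun z => b z * fcoord F s c (Z z)) x = dlin A (fun z => fcoord F s c (Z z)) x.
  move=> hZ c; apply: dlin_near; first exact: coordS.
  by apply: filterS b1 => z /= ->; rewrite mul1r.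
transitivity (\sum_c \sum_d (
   (fcoord F s c (X x) * dlin A (fun z => fcoord F s d (Y z)) x (lanchor eps x (e c x))) *: e d x
   - (fcoord F s d (Y x) * dlin A (fun z => fcoord F s c (X z)) x (ranchor eps x (e d x))) *: e c x
   + (fcoord F s c (X x) * fcoord F s d (Y x)) *: bracket eps (e c) (e d) x)).
  apply: eq_bigr => c _; rewrite bracket_sumr; last 2 first.
  - by apply: smooth_section_scale => // z; exact: coordS.
  - by move=> d; apply: smooth_section_scale => // z; exact: coordS.
  apply: eq_bigr => d _; rewrite leib //; last 2 first.
  - by apply: smooth_fun_setT => z; exact: coordS.
  - by apply: smooth_fun_setT => z; exact: coordS.
  by rewrite !dcoord // bx !mul1r.
have ex c : e c x = tnth (frame F s x) c by have := mnbhs_singleton hA eE; exact.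
have sumX Z : \sum_c fcoord F s c (Z x) *: e c x = Z x.
  by rewrite [RHS](fcoord_sum hE _ sx); apply: eq_bigr => c _; rewrite ex.
(* In each anchor term one of the two indices occurs only in a coordinate and inside the anchor;
   summing over it reassembles [X x] or [Y x] there. *)
under eq_bigr => c _ do rewrite big_split sumrB /=.
rewrite big_split sumrB /=; congr (_ - _ + _).
  rewrite exchange_big /=; apply: eq_bigr => d _.
  rewrite -scaler_suml -{2}(sumX X) !linear_sum /=; congr (_ *: _).
  by apply: eq_bigr => c _; rewrite !linearZ.
apply: eq_bigr => c _.
rewrite -scaler_suml -{2}(sumX Y) !linear_sum /=; congr (_ *: _).
by apply: eq_bigr => d _; rewrite !linearZ.
Qed.

End Bracket.

(** * Submanifolds and extension of sections *)

Section Submanifold.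
Variables (R : realType) (M : Type) (m : nat) (A : atlas R M m).
Hypothesis hA : is_manifold A.
Variables (S : set M) (k : nat) (AS : atlas R {x : M | S x} k).
Hypothesis hS : is_submanifold A AS.
Implicit Types (y z : {x : M | S x}) (P : set M) (f : M -> R).

#[local] Existing Instance mnbhs_filter.

Let hAS : is_manifold AS := hS.1.

(** Slice coordinates of index >= k vanish on the submanifold, so padding with zeros undoes
    truncation there. One [pid_mx] is thus the local form of the inclusion, the other that of a
    local retraction onto the submanifold; both are linear, hence smooth. *)
Lemma slice_chart y : exists (kappa : chart R M m) (iota : chart R {x : M | S x} k),
  [/\ compatible A kappa, compatible AS iota, cdom kappa (sval y), cdom iota y &
   forall z, cdom iota z -> [/\ cdom kappa (sval z),
     cmap kappa (sval z) *m (pid_mx k : 'M[R]_(m, k)) = cmap iota z &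
     cmap iota z *m (pid_mx k : 'M[R]_(k, m)) = cmap kappa (sval z)]].
Proof.
have [kappa [iota [hk hi ky kS [di ci]]]] := hS.2 y.
exists kappa, iota; split=> //; first exact/di.
move=> z zi; have kz := (di z).1 zi; split=> //; rewrite ci // -mulmxA mul_pid_mx !minnn.
apply/rowP => j; rewrite !mxE (bigD1 j) //= big1 ?addr0 => [|i ij].
  rewrite mxE eqxx /=; case: ltnP => [_|kj]; first by rewrite mulr1.
  by rewrite mulr0 ((kS _ kz).1 (svalP z)).
by move: ij; rewrite mxE -val_eqE => /negbTE ->; rewrite mulr0.
Qed.

Lemma sval_mnbhs y P : mnbhs A (sval y) P -> mnbhs AS y [set z | P (sval z)].
Proof.
have [kappa [iota [hk hi ky iy sl]]] := slice_chart y.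
move=> /(mnbhsP hA _ hk ky) nP; apply/(mnbhsP hAS _ hi iy).
have [_ _ e] := sl y iy.
have cont : {for cmap iota y, continuous (mulmxr (pid_mx k : 'M[R]_(k, m)))}.
  exact: linear_rV_continuous.
have : \forall u \near cmap iota y, P (cinv kappa (u *m (pid_mx k : 'M[R]_(k, m)))).
  by apply: (cont (fun u => P (cinv kappa u))); rewrite /= e.
apply: filterS2 (chart_inv_near hi.1 iy) => u [iu ue] /=.
by have [kz _ h] := sl _ iu; rewrite -{1}ue h (cmapK hk.1 kz).
Qed.

Definition incl_chart y : 'rV[R]_k -> 'rV[R]_m :=
  cmap (chart_at A (sval y)) \o sval \o cinv (chart_at AS y).

(** Between slice charts the inclusion is linear padding; transition maps on both sides carry this
    to the preferred charts. *)
Lemma incl_chart_smooth y : smooth_at (incl_chart y) (cmap (chart_at AS y) y).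
Proof.
rewrite /incl_chart; set c := chart_at A _; set c' := chart_at AS _.
have hc : compatible A c by exact: compatible_chart_at.
have hc' : compatible AS c' by exact: compatible_chart_at.
have cy : cdom c (sval y) by exact: cdom_chart_at.
have c'y : cdom c' y by exact: cdom_chart_at.
have [kappa [iota [hk hi ky iy sl]]] := slice_chart y.
have [_ _ e] := sl y iy.
have ck : chart_compat kappa c by exact: hk.2.
have ci : chart_compat c' iota by exact/chart_compat_sym/hi.2.
apply: (@smooth_at_eq _ _ _ ((cmap c \o cinv kappa) \o
   ((mulmxr (pid_mx k : 'M[R]_(k, m))) \o (cmap iota \o cinv c')))).
  apply: (near_chart (P := fun z => cmap c (cinv kappa (cmap iota z *m
    (pid_mx k : 'M[R]_(k, m)))) = cmap c (sval z)) hc'.1 hi.1 ci c'y iy).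
  apply: filterS (chart_inv_near hi.1 iy) => u [iu ue] /=.
  by have [kz _ ->] := sl _ iu; rewrite (cmapK hk.1 kz).
have s1 : smooth_at (cmap iota \o cinv c') (cmap c' y).
  exact: transition_smooth ci c'y iy.
have s2 : smooth_at (mulmxr (pid_mx k : 'M[R]_(k, m)) \o (cmap iota \o cinv c')) (cmap c' y).
  by apply: smooth_at_comp_rV s1 _; exact: smooth_at_linear_rV.
apply: smooth_at_comp_rV s2 _.
rewrite /= (cmapK hc'.1 c'y) e.
exact: transition_smooth ck ky cy.
Qed.

Lemma tangent_inclE y v : tangent_incl A AS y v =
  'd (incl_chart y) (cmap (chart_at AS y) y) v.
Proof. by rewrite /tangent_incl /tlin lfunE. Qed.

Lemma incl_chart_near y :
  \forall u \near cmap (chart_at AS y) y,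
    cinv (chart_at A (sval y)) (incl_chart y u) = sval (cinv (chart_at AS y) u).
Proof.
have := sval_mnbhs (cdom_mnbhs hA (compatible_chart_at hA (sval y)) (cdom_chart_at hA (sval y))).
rewrite mnbhsE; apply: filterS => u /= h.
by rewrite /incl_chart /= (cmapK (compatible_chart_at hA (sval y)).1 h).
Qed.

Lemma incl_chartE y : incl_chart y (cmap (chart_at AS y) y) = cmap (chart_at A (sval y)) (sval y).
Proof.
by rewrite /incl_chart /= (cmapK (compatible_chart_at hAS y).1 (cdom_chart_at hAS y)).
Qed.

Lemma msmooth_sval f y : msmooth A f (sval y) -> msmooth AS (f \o sval) y.
Proof.
move=> fy; apply: (@smooth_at_eq _ _ _ ((f \o cinv (chart_at A (sval y)) : 'rV[R]_m -> R^o) \o incl_chart y)).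
  by apply: filterS (incl_chart_near y) => u /= ->.
by apply: smooth_at_comp; [exact: incl_chart_smooth|rewrite incl_chartE].
Qed.

Lemma dlin_sval f y v : msmooth A f (sval y) ->
  dlin AS (f \o sval) y v = dlin A f (sval y) (tangent_incl A AS y v).
Proof.
move=> fy; rewrite [LHS]dlinE [RHS]dlinE tangent_inclE.
set F := (f \o cinv _ : 'rV[R]_m -> R^o).
have dF : differentiable F (incl_chart y (cmap (chart_at AS y) y)).
  by rewrite incl_chartE; exact: smooth_at_differentiable fy.
have di := smooth_at_differentiable (incl_chart_smooth y).
have dc : differentiable (F \o incl_chart y) (cmap (chart_at AS y) y).
  exact: differentiable_comp.
rewrite -(near_eq_diff dc); last first.
  by apply: filterS (incl_chart_near y) => u h; rewrite /F /= h.
by rewrite (diff_comp di dF) /= incl_chartE.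
Qed.

(** Truncating slice coordinates gives a smooth local left inverse [g] of the inclusion, and by the
    chain rule its differential is a left inverse of the tangent map. *)
Lemma tangent_incl_inj y : lker (tangent_incl A AS y) == 0%VS.
Proof.
have [kappa [iota [hk hi ky iy sl]]] := slice_chart y.
have [_ e1 e] := sl y iy.
set c := chart_at A (sval y); set c' := chart_at AS y.
have hc : compatible A c by exact: compatible_chart_at.
have hc' : compatible AS c' by exact: compatible_chart_at.
have cy : cdom c (sval y) by exact: cdom_chart_at.
have c'y : cdom c' y by exact: cdom_chart_at.
pose g := (cmap c' \o cinv iota) \o
  (mulmxr (pid_mx k : 'M[R]_(m, k)) \o (cmap kappa \o cinv c)).
have gs : smooth_at g (incl_chart y (cmap c' y)).
  rewrite /incl_chart /= (cmapK hc'.1 c'y).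
  have s1 : smooth_at (cmap kappa \o cinv c) (cmap c (sval y)).
    by apply: transition_smooth => //; exact/chart_compat_sym/hk.2.
  apply: smooth_at_comp_rV.
    by apply: smooth_at_comp_rV s1 _; exact: smooth_at_linear_rV.
  rewrite /= (cmapK hc.1 cy) e1.
  by apply: transition_smooth => //; exact: hi.2.
have gid : \forall u \near cmap c' y, (g \o incl_chart y) u = u.
  have n1 := sval_mnbhs (cdom_mnbhs hA hc cy); rewrite mnbhsE in n1.
  have n2 : \forall u \near cmap c' y, cdom iota (cinv c' u).
    exact/(mnbhsP hAS _ hc' c'y)/(cdom_mnbhs hAS hi iy).
  apply: filterS3 n1 n2 (chart_inv_near hc'.1 c'y) => u /= h1 h2 [h3 h4].
  have [_ h _] := sl _ h2; rewrite /incl_chart /g /=.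
  by rewrite (cmapK hc.1 h1) h (cmapK hi.1 h2).
have ds := smooth_at_differentiable (incl_chart_smooth y).
have dg := smooth_at_differentiable gs.
apply/lker0P => u v; rewrite !tangent_inclE => uv.
have h w : 'd g (incl_chart y (cmap c' y)) ('d (incl_chart y) (cmap c' y) w) = w.
  have := diff_comp ds dg => /(congr1 (fun h => h w)) /= <-.
  have did : differentiable (id : 'rV[R]_k -> 'rV[R]_k) (cmap c' y) by [].
  rewrite -(near_eq_diff did); first by rewrite diff_val.
  by apply: filterS gid => x /= ->.
by rewrite -(h u) -(h v) uv.
Qed.

End Submanifold.

Section Extension.
Variables (R : realType) (M : Type) (m : nat) (A : atlas R M m).
Hypothesis hA : is_manifold A.
Variables (n : nat) (E : M -> vectType R) (F : framing E n).
Hypothesis hE : is_vbundle A F.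
Variables (S : set M) (k : nat) (AS : atlas R {x : M | S x} k).
Hypothesis hS : is_submanifold A AS.
Variable D : forall y : {x : M | S x}, {vspace E (sval y)}.
Variables (r : nat) (FD : framing (sub_fib D) r).
Hypothesis hD : is_subbundle F AS FD.
Implicit Types (y z : {x : M | S x}) (X : section (sub_fib D)).

#[local] Existing Instance mnbhs_filter.

Let hAS : is_manifold AS := hS.1.

Lemma sub_incl_smooth t s a b y : fdom FD t y -> fdom F s (sval y) ->
  msmooth AS (fun z => fcoord F s b (sub_incl D z (tnth (frame FD t z) a))) y.
Proof.
move=> ty sy; have /(smooth_funP hAS) [_] := hD.2 t s a b; apply.
by split.
Qed.

Lemma sub_incl_coord_smooth X s b y : fdom F s (sval y) ->
  smooth_section_at AS FD X y ->
  msmooth AS (fun z => fcoord F s b (sub_incl D z (X z))) y.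
Proof.
move=> sy hX; pose t := fpref FD y.
have ty : fdom FD t y := fdom_pref hD.1 y.
apply: (@msmooth_near _ _ _ _ (fun z => \sum_a fcoord FD t a (X z) *
    fcoord F s b (sub_incl D z (tnth (frame FD t z) a)))).
  apply: filterS (fdom_mnbhs hAS hD.1 ty) => z tz /=.
  rewrite {2}(fcoord_sum hD.1 (X z) tz) /fcoord !linear_sum /=.
  by apply: eq_bigr => a _; rewrite !linearZ.
apply: msmooth_sum => a; apply: msmoothM; first exact: hX.
exact: sub_incl_smooth.
Qed.

Lemma extensionP X y : mnbhs AS y (smooth_section_at AS FD X) ->
  smooth_section A F (extension A F AS X y) /\
  mnbhs AS y [set z | extension A F AS X y (sval z) = sub_incl D z (X z)].
Proof.
move=> hX; have [kappa [iota [hk hi ky iy sl]]] := slice_chart hS y.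
have [_ e1 _] := sl y iy.
set s := fpref F (sval y); have sy : fdom F s (sval y) := fdom_pref hE (sval y).
pose p : 'rV[R]_m -> 'rV[R]_k := mulmxr (pid_mx k : 'M[R]_(m, k)).
pose c b z : R := fcoord F s b (sub_incl D z (X z)).
have nc : mnbhs AS y [set z | forall b, msmooth AS (c b) z].
  apply: filterS2 hX (sval_mnbhs hA hS (fdom_mnbhs hA hE sy)) => z Xz sz b.
  exact: sub_incl_coord_smooth.
(* The coordinates of X are kept constant along the fibres of the local retraction that truncates
   slice coordinates. The frame [s] is already defined off the submanifold, so this is a smooth
   section of E near the point, which a bump function then makes global. *)
pose Y : section E := fun x => \sum_b c b (cinv iota (p (cmap kappa x))) *:
   tnth (frame F s x) b.
have YX : mnbhs AS y [set z | Y (sval z) = sub_incl D z (X z)].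
  apply: filterS2 (cdom_mnbhs hAS hi iy) (sval_mnbhs hA hS (fdom_mnbhs hA hE sy)).
  move=> z iz sz /=; have [_ h _] := sl _ iz.
  rewrite [RHS](fcoord_sum hE _ sz); apply: eq_bigr => b _.
  by rewrite /p /= h (cmapK hi.1 iz).
have Ys : mnbhs A (sval y) (smooth_section_at A F Y).
  have cont : {for cmap kappa (sval y), continuous p} by exact: linear_rV_continuous.
  have : \forall w \near cmap kappa (sval y), (cdom iota (cinv iota (p w)) /\
      cmap iota (cinv iota (p w)) = p w) /\ (forall b, msmooth AS (c b) (cinv iota (p w))).
    apply: (cont (fun u => (cdom iota (cinv iota u) /\ cmap iota (cinv iota u) = u) /\
      forall b, msmooth AS (c b) (cinv iota u))); rewrite /p /= e1.
    apply: filterS2 (chart_inv_near hi.1 iy) ((mnbhsP hAS _ hi iy).1 nc) => u; by split.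
  move=> nw.
  have nk : mnbhs A (sval y) [set x | (cdom iota (cinv iota (p (cmap kappa x))) /\
      cmap iota (cinv iota (p (cmap kappa x))) = p (cmap kappa x)) /\
      (forall b, msmooth AS (c b) (cinv iota (p (cmap kappa x))))].
    apply/(mnbhsP hA _ hk ky); apply: filterS2 (chart_inv_near hk.1 ky) nw => w [kw ew].
    by rewrite /= ew.
  apply: filterS3 (cdom_mnbhs hA hk ky) (fdom_mnbhs hA hE sy) nk => x kx sx [[i1 i2] cs].
  apply: smooth_section_at_sum => b; apply: smooth_section_at_scale; last exact: smooth_section_at_frame.
  apply: (msmooth_chart (g := (c b \o cinv iota : _ -> R^o) \o p) hA hk kx).
  apply: smooth_at_comp; first exact: smooth_at_linear_rV.
  by rewrite -[X in smooth_at _ X]i2; apply/(msmoothP hAS _ hi i1).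
have [Y' [Y's [W [oW Wy Y'Y]]]] := section_germ_extends hA hE Ys.
have /pick_sectionP : exists X' : section E, smooth_section A F X' /\
    exists W, [/\ mopen AS W, W y &
      forall z, W z -> X' (sval z) = sub_incl D z (X z)].
  exists Y'; split=> //.
  have nW : mnbhs A (sval y) W by move/(mopenP hA): oW; exact.
  have [W' [oW' W'y hW']] := mnbhs_mopen hAS (filterI (sval_mnbhs hA hS nW) YX).
  by exists W'; split=> // z /hW' [/= Wz <-]; exact: Y'Y.
move=> [h1 [W' [oW' W'y h2]]]; split=> //.
by move/(mopenP hAS)/(_ y W'y): oW'; exact: filterS.
Qed.

End Extension.

(** * Vector bundle morphisms in coordinates *)

Section BundleMaps.
Variables (R : realType) (m n m' n' : nat).
Variables (g : 'rV[R]_m -> 'rV[R]_m') (psi : 'I_n' -> 'I_n -> 'rV[R]_m -> R^o).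
Implicit Types (u w : 'rV[R]_(m + n)).

(* The local form of a vector bundle morphism over [g]. *)
Definition bundle_map u : 'rV[R]_(m' + n') :=
  row_mx (g (lsubmx u)) (\row_b \sum_a rsubmx u 0 a * psi b a (lsubmx u)).

Lemma lsubmx_smooth u : smooth_at (lsubmx : 'rV[R]_(m + n) -> 'rV[R]_m) u.
Proof. exact: smooth_at_linear_rV. Qed.

Lemma rsubmx_smooth u a : smooth_at (fun u : 'rV[R]_(m + n) => rsubmx u 0 a : R^o) u.
Proof.
apply: (@smooth_at_entry _ _ _ (rsubmx : 'rV[R]_(m + n) -> 'rV[R]_n)).
exact: smooth_at_linear_rV.
Qed.

Variable u : 'rV[R]_(m + n).
Hypothesis gs : smooth_at g (lsubmx u).
Hypothesis psis : forall b a, smooth_at (psi b a) (lsubmx u).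

Let entry b a (x : 'rV[R]_(m + n)) : R^o := rsubmx x 0 a * psi b a (lsubmx x).

Let entry_smooth b a : smooth_at (entry b a) u.
Proof.
apply: smooth_at_mul; first exact: rsubmx_smooth.
by apply: (@smooth_at_comp _ _ _ lsubmx (psi b a)) => //; exact: lsubmx_smooth.
Qed.

Lemma bundle_map_smooth : smooth_at bundle_map u.
Proof.
apply: smooth_at_row => j; rewrite -(splitK j); case: (fintype.split j) => i /=.
  apply: (@smooth_at_eq _ _ _ (fun x => (g \o lsubmx) x 0 i : R^o)).
    by apply: filterE => x; rewrite /bundle_map row_mxEl.
  by apply: smooth_at_entry; apply: smooth_at_comp_rV => //; exact: lsubmx_smooth.
apply: (@smooth_at_eq _ _ _ (fun x => \sum_a entry i a x)).
  by apply: filterE => x; rewrite /bundle_map row_mxEr mxE.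
exact: smooth_at_sum.
Qed.

(** Product rule in the fibre coordinates. The inclusion of D, the inclusion of the restricted dual
    bundle and $i_D^*$ are all locally of the form [bundle_map], so their differentials are
    instances of this formula. *)
Lemma diff_bundle_map w : 'd bundle_map u w =
  row_mx ('d g (lsubmx u) (lsubmx w))
    (\row_b \sum_a (rsubmx w 0 a * psi b a (lsubmx u)
                    + rsubmx u 0 a * 'd (psi b a) (lsubmx u) (lsubmx w))).
Proof.
have db := smooth_at_differentiable bundle_map_smooth.
have dl : differentiable (lsubmx : 'rV[R]_(m + n) -> 'rV[R]_m) u.
  exact: smooth_at_differentiable (lsubmx_smooth u).
have dg := smooth_at_differentiable gs.
have lsubE x : 'd (lsubmx : 'rV[R]_(m + n) -> 'rV[R]_m) u x = lsubmx x.
  by rewrite (diff_lin (f := lsubmx : {linear 'rV[R]_(m + n) -> 'rV[R]_m})) //;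
     exact: linear_rV_continuous.
have rsubE a x : 'd (fun u : 'rV[R]_(m + n) => rsubmx u 0 a : R^o) u x = rsubmx x 0 a.
  rewrite -[LHS]deriveE; last exact: smooth_at_differentiable (rsubmx_smooth u a).
  have dr : differentiable (rsubmx : 'rV[R]_(m + n) -> 'rV[R]_n) u.
    exact: differentiable_rsubmx.
  rewrite (derive_entry x a dr) deriveE //.
  by rewrite (diff_lin (f := rsubmx : {linear 'rV[R]_(m + n) -> 'rV[R]_n})) //;
     exact: linear_rV_continuous.
apply/rowP => j; rewrite -deriveE // -derive_entry //.
rewrite -(splitK j); case: (fintype.split j) => i /=.
  rewrite row_mxEl (_ : (fun x => _) = (fun x => (g \o lsubmx) x 0 i : R^o)); last first.
    by apply/funext => x; rewrite /bundle_map row_mxEl.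
  have dgl : differentiable (g \o (lsubmx : 'rV[R]_(m + n) -> _)) u.
    exact: differentiable_comp.
  by rewrite derive_entry // deriveE // diff_comp //= lsubE.
rewrite row_mxEr mxE (_ : (fun x => _) = \sum_a entry i a); last first.
  by apply/funext => x; rewrite /bundle_map row_mxEr mxE fct_sumE.
have de a : differentiable (entry i a) u by exact: smooth_at_differentiable (entry_smooth i a).
rewrite derive_sum; last by move=> a; exact: diff_derivable.
apply: eq_bigr => a _.
have d1 := smooth_at_differentiable (rsubmx_smooth u a).
have d2 : differentiable (psi i a \o (lsubmx : 'rV[R]_(m + n) -> _)) u.
  by apply: differentiable_comp => //; exact: smooth_at_differentiable (psis i a).
rewrite (@deriveM _ _ (fun u : 'rV[R]_(m + n) => rsubmx u 0 a : R^o)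
  (psi i a \o lsubmx)); try exact: diff_derivable.
rewrite deriveE // deriveE // rsubE diff_comp //; last exact: smooth_at_differentiable (psis i a).
by rewrite /= lsubE addrC /GRing.scale /= [psi _ _ _ * _]mulrC.
Qed.

End BundleMaps.

Section DualFrames.
Variables (R : realType) (T : Type) (m : nat) (A : atlas R T m).
Variables (n : nat) (E : T -> vectType R) (F : framing E n).
Hypothesis hE : is_vbundle A F.
Implicit Types (x : T) (s : fidx F).

Lemma dual_frameE s x a (v : E x) :
  tnth (frame (dual_framing F) s x) a v = fcoord F s a v.
Proof. by rewrite tnth_mktuple /fcoord lfunE. Qed.

Lemma dual_sum s x (xi : dual_fib E x) : fdom F s x ->
  xi = \sum_a xi (tnth (frame F s x) a) *: tnth (frame (dual_framing F) s x) a.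
Proof.
move=> sx; apply/lfunP => v; rewrite sum_lfunE {1}(fcoord_sum hE v sx) linear_sum.
apply: eq_bigr => a _; rewrite linearZ lfunE /= dual_frameE.
by rewrite /GRing.scale /= mulrC.
Qed.

(** [coord] reads off coefficients only for a free family; the dual frame is free because evaluation
    on the frame vectors isolates each coefficient. *)
Lemma fcoord_dual s x a (xi : dual_fib E x) : fdom F s x ->
  fcoord (dual_framing F) s a xi = xi (tnth (frame F s x) a).
Proof.
move=> sx; rewrite {1}(dual_sum xi sx) /fcoord.
under eq_bigr => i _ do rewrite [X in _ *: X](tnth_nth 0).
rewrite coord_sum_free //; apply/freeP => c c0 i.
have e0 : \sum_j c j *: tnth (frame (dual_framing F) s x) j = 0.
  by rewrite -[RHS]c0; apply: eq_bigr => j _; rewrite [X in _ *: X](tnth_nth 0).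
have := congr1 (fun f : dual_fib E x => f (tnth (frame F s x) i)) e0.
rewrite sum_lfunE (bigD1 i) //= big1 ?addr0 => [|j ji].
  rewrite scale_lfunE dual_frameE (fcoord_frame hE) // eqxx lfunE => h.
  by rewrite -[c i]mulr1.
by rewrite scale_lfunE dual_frameE (fcoord_frame hE) // (negbTE ji) scaler0.
Qed.

End DualFrames.

(** * Orthogonal projection in a single inner product space *)

Section Orthogonal.
Variables (R : realType) (E : vectType R) (G : E -> E -> R).
Hypothesis Gl : forall (c : R) u v w, G (c *: u + v) w = c * G u w + G v w.
Hypothesis Gsym : forall u v, G u v = G v u.
Hypothesis Gpos : forall u, u != 0 -> 0 < G u u.
Variables (D Dperp : {vspace E}).
Hypothesis hD : forall e, e \in Dperp <-> forall d, d \in D -> G d e = 0.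

Lemma metric_linear e : linear (G e : E -> R^o).
Proof. by move=> c u v; rewrite ![G e _]Gsym Gl. Qed.

Lemma metric_sum e k (c : 'I_k -> R) (v : 'I_k -> E) :
  G e (\sum_i c i *: v i) = \sum_i c i * G e (v i).
Proof.
pose f : {linear E -> R^o} := HB.pack (G e : E -> R^o)
  (GRing.isLinear.Build _ _ _ _ (G e : E -> R^o) (metric_linear e)).
rewrite -[LHS]/(f _) linear_sum; apply: eq_bigr => i _; by rewrite linearZ.
Qed.

Lemma metricDr e u v : G e (u + v) = G e u + G e v.
Proof. by have := metric_linear e 1 u v; rewrite !scale1r. Qed.

Lemma ortho_cap : (D :&: Dperp = 0)%VS.
Proof.
apply/eqP; rewrite -subv0; apply/subvP => u; rewrite memv_cap memv0 => /andP[uD /hD /(_ u uD)].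
by move=> Gu; apply/negPn/negP => /Gpos; rewrite Gu ltxx.
Qed.

(** Pairing with a basis of D is a linear map [f] to row vectors of length dim D whose kernel lies
    in [Dperp]. It is therefore injective on D, hence maps D onto all row vectors by dimension, and
    some d in D has the same image as u. *)
Lemma ortho_decomp u : exists2 d, d \in D & u - d \in Dperp.
Proof.
pose b := vbasis D.
pose f (d : E) : 'rV[R]_(\dim D) := \row_i G (tnth b i) d.
have fl : linear f.
  by move=> c d d'; apply/rowP => i; rewrite !mxE metric_linear.
pose fL : {linear E -> 'rV[R]_(\dim D)} := HB.pack f (GRing.isLinear.Build _ _ _ _ f fl).
have f0 d : f d = 0 -> d \in Dperp.
  move=> fd; apply/hD => d' /coord_vbasis ->; rewrite Gsym.
  rewrite metric_sum big1 // => i _; rewrite Gsym -tnth_nth.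
  by move/rowP: fd => /(_ i); rewrite !mxE => ->; rewrite mulr0.
have ker : (D :&: lker (linfun fL) = 0)%VS.
  apply/eqP; rewrite -subv0 -ortho_cap; apply: capvS => //.
  by apply/subvP => d; rewrite memv_ker lfunE => /eqP /f0.
have img : (linfun fL @: D)%VS = fullv.
  apply/eqP; rewrite eqEdim subvf limg_dim_eq // dimvf /=.
  by rewrite /dim /= mul1n.
have : f u \in (linfun fL @: D)%VS by rewrite img memvf.
case/memv_imgP => d dD; rewrite lfunE => fu; exists d => //.
by apply: f0; rewrite -[LHS]/(fL (u - d)) linearB /= fu subrr.
Qed.

(** [daddv_pi] splits a vector correctly only if the sum is direct and contains the vector;
    [ortho_cap] and [ortho_decomp] supply this. The discarded component is orthogonal to e. *)
Lemma ortho_proj e u : e \in D -> G e (daddv_pi D Dperp u) = G e u.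
Proof.
move=> eD; have [d dD ud] := ortho_decomp u.
have uDD : u \in (D + Dperp)%VS.
  by rewrite -[u](subrKC d) memv_add.
rewrite -{2}(daddv_pi_add ortho_cap uDD) metricDr.
rewrite [X in _ + X](_ : _ = 0) ?addr0 //.
by have /hD := memv_pi Dperp D u; exact.
Qed.

End Orthogonal.

(** * Smoothness and fibre derivative of the mechanical Lagrangian *)

Section Mechanical.
Variables (R : realType) (T : Type) (m : nat) (A : atlas R T m).
Hypothesis hA : is_manifold A.
Variables (n : nat) (E : T -> vectType R) (F : framing E n).
Hypothesis hE : is_vbundle A F.
Variable G : forall x, E x -> E x -> R.
Hypothesis hG : is_bundle_metric A F G.
Variable V : T -> R.
Hypothesis hV : smooth_fun A (V:=R^o) setT V.
Implicit Type e : total_space E.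

Let L := mechanical_lagrangian G V.
Let tc e := chart_at (total_atlas A F) e.

Lemma mechanical_smooth e :
  smooth_at (L \o cinv (tc e) : 'rV[R]_(m + n) -> R^o) (cmap (tc e) e).
Proof.
have [Gl Gs Gp Gsm] := hG.
set c := chart_at A (tag e); set s := fpref F (tag e).
have sx : fdom F s (tag e) := fdom_pref hE (tag e).
pose g a b x : R := G (tnth (frame F s x) a) (tnth (frame F s x) b).
have lu0 : lsubmx (cmap (tc e) e) = cmap c (tag e) by rewrite row_mxKl.
have base (f : T -> R) : msmooth A f (tag e) ->
    smooth_at (fun u : 'rV[R]_(m + n) => f (cinv c (lsubmx u)) : R^o) (cmap (tc e) e).
  move=> fs; apply: (@smooth_at_comp _ _ _ lsubmx (f \o cinv c : 'rV[R]_m -> R^o)).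
    exact: lsubmx_smooth.
  by rewrite lu0.
apply: (@smooth_at_eq _ _ _ (fun u : 'rV[R]_(m + n) =>
   2^-1 * (\sum_a \sum_b (rsubmx u 0 a * (rsubmx u 0 b * g a b (cinv c (lsubmx u)))))
   + (-1) * V (cinv c (lsubmx u)) : R^o)).
  (* The formula, quadratic in the fibre coordinates, holds at every row vector: the inverse of the
     total chart is by definition a combination of frame vectors. *)
  apply: filterE => u; rewrite /L /mechanical_lagrangian /= mulN1r; congr (_ * _ - _).
  rewrite (metric_sum (Gl _) (Gs _)) exchange_big /=; apply: eq_bigr => b _.
  rewrite Gs (metric_sum (Gl _) (Gs _)) mulr_sumr; apply: eq_bigr => a _.
  by rewrite /g Gs mulrCA.
apply: smooth_at_add.
  apply: smooth_at_mul; first exact: smooth_at_cst.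
  apply: smooth_at_sum => a; apply: smooth_at_sum => b.
  apply: smooth_at_mul; first exact: rsubmx_smooth.
  apply: smooth_at_mul; first exact: rsubmx_smooth.
  by apply: (base (g a b)); have /(smooth_funP hA) [_] := Gsm s a b; exact.
apply: smooth_at_mul; first exact: smooth_at_cst.
by apply: base; have /(smooth_funP hA) [_] := hV; exact.
Qed.

Lemma dlin_mechanical_fibre e (w : 'rV[R]_n) :
  dlin (total_atlas A F) L e (row_mx 0 w) =
  G (tagged e) (\sum_a w 0 a *: tnth (frame F (fpref F (tag e)) (tag e)) a).
Proof.
have [Gl Gs Gp Gsm] := hG.
rewrite dlinE -/(tc e) -deriveE; last exact: smooth_at_differentiable (mechanical_smooth e).
set c := chart_at A (tag e); set s := fpref F (tag e).
have sx : fdom F s (tag e) := fdom_pref hE (tag e).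
set v := \sum_a _.
have chartE (z : 'rV[R]_n) : (L \o cinv (tc e)) (row_mx (cmap c (tag e)) z) =
    L (Tagged E (\sum_a z 0 a *: tnth (frame F s (tag e)) a)).
  rewrite /tc /= row_mxKl row_mxKr.
  by rewrite (cmapK (compatible_chart_at hA (tag e)).1 (cdom_chart_at hA (tag e))).
have eE : tagged e = \sum_a fcoord F s a (tagged e) *: tnth (frame F s (tag e)) a.
  exact: (fcoord_sum hE (tagged e) sx).
pose z0 : 'rV[R]_n := \row_a fcoord F s a (tagged e).
apply: cvg_lim => //.
(* On a fibre L is quadratic and the potential is constant, so the difference quotient is exactly
   G(e, v) + (h/2) G(v, v). *)
apply: (@cvg_trans _ ((fun h : R => G (tagged e) v + h * (2^-1 * G v v)) @ 0^')).
  apply: near_eq_cvg; near=> h.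
  have hN0 : h != 0 by near: h; exact: nbhs_dnbhs_neq.
  transitivity (h^-1 *: ((L \o cinv (tc e)) (row_mx (cmap c (tag e)) (h *: w + z0))
      - (L \o cinv (tc e)) (row_mx (cmap c (tag e)) z0)) : R^o); last first.
    by rewrite -[cmap c (tag e) in X in X - _]add0r -add_row_mx -[X in row_mx X _](scaler0 _ h) -scale_row_mx.
  rewrite !chartE.
  rewrite (_ : \sum_a (h *: w + _) 0 a *: _ = tagged e + h *: v); last first.
    rewrite [in RHS]eE scaler_sumr -big_split; apply: eq_bigr => a _ /=.
    by rewrite !mxE scalerA -scalerDl addrC.
  rewrite (_ : \sum_a _ = tagged e); last first.
    by rewrite [RHS]eE; apply: eq_bigr => a _; rewrite mxE.
  rewrite /L /mechanical_lagrangian /=.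
  have Gr x u1 u2 k u3 : G (k *: u1 + u2) u3 = k * @G x u1 u3 + G u2 u3 by exact: Gl.
  have -> : G (tagged e + h *: v) (tagged e + h *: v) =
     G (tagged e) (tagged e) + 2 * h * G (tagged e) v + h * h * G v v.
    rewrite addrC Gr [G v _]Gs [G (tagged e) _]Gs !Gr.
    rewrite (Gs _ v (tagged e)); ring.
  by rewrite /GRing.scale /=; field.
have lim : (fun h : R => G (tagged e) v + h * (2^-1 * G v v)) @ 0^' -->
    G (tagged e) v + 0 * (2^-1 * G v v).
  apply: cvgD; first exact: cvg_cst.
  by apply: cvgM; [exact: nbhs_dnbhs|exact: cvg_cst].
by rewrite mul0r addr0 in lim.
Unshelve. all: by end_near. Qed.

End Mechanical.

(** * Tangent maps of the inclusions over the submanifold and of the restriction of forms to D *)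

Section TangentMaps.
Variables (R : realType) (M : Type) (m : nat) (A : atlas R M m).
Hypothesis hA : is_manifold A.
Variables (n : nat) (E : M -> vectType R) (F : framing E n).
Hypothesis hE : is_vbundle A F.
Variables (S : set M) (k : nat) (AS : atlas R {x : M | S x} k).
Hypothesis hS : is_submanifold A AS.
Variable D : forall y : {x : M | S x}, {vspace E (sval y)}.
Variables (r : nat) (FD : framing (sub_fib D) r).
Hypothesis hD : is_subbundle F AS FD.
Implicit Types (y z : {x : M | S x}).

#[local] Existing Instance mnbhs_filter.

Let hAS : is_manifold AS := hS.1.

Definition incl_coord t s b a z : R :=
  fcoord F s b (sub_incl D z (tnth (frame FD t z) a)).

Lemma lsubmx_near (p q : nat) (u : 'rV[R]_(p + q)) (P : 'rV[R]_p -> Prop) :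
  (\forall x \near lsubmx u, P x) -> \forall x \near u, P (lsubmx x).
Proof.
have : {for u, continuous (lsubmx : 'rV[R]_(p + q) -> 'rV[R]_p)}.
  exact/differentiable_continuous/differentiable_lsubmx.
exact.
Qed.

Lemma dlin_tot_incl (L : total_space E -> R) (d : total_space (sub_fib D)) w :
  let e := tot_incl d in
  let y := tag d in
  let t := fpref FD y in
  let s := fpref F (sval y) in
  smooth_at (L \o cinv (chart_at (total_atlas A F) e) : 'rV[R]_(m + n) -> R^o)
    (cmap (chart_at (total_atlas A F) e) e) ->
  dlin (total_atlas AS FD) (L \o @tot_incl R M E S D) d w =
  dlin (total_atlas A F) L e
    (row_mx (tangent_incl A AS y (lsubmx w))
       (\row_b \sum_a (rsubmx w 0 a * incl_coord t s b a y
           + fcoord FD t a (tagged d) * dlin AS (incl_coord t s b a) y (lsubmx w)))).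
Proof.
move=> e y t s Ls.
have ty : fdom FD t y := fdom_pref hD.1 y.
have sy : fdom F s (sval y) := fdom_pref hE (sval y).
set c := chart_at A (sval y); set c' := chart_at AS y.
set u0 := cmap (chart_at (total_atlas AS FD) d) d.
have lu0 : lsubmx u0 = cmap c' y by rewrite /u0 row_mxKl.
have ru0 a : rsubmx u0 0 a = fcoord FD t a (tagged d) by rewrite /u0 row_mxKr mxE.
pose psi b a : 'rV[R]_k -> R^o := incl_coord t s b a \o cinv c'.
have psis b a : smooth_at (psi b a) (lsubmx u0).
  by rewrite lu0; exact: (sub_incl_smooth hS hD a b ty sy).
have gs : smooth_at (incl_chart A AS y) (lsubmx u0).
  by rewrite lu0; exact: incl_chart_smooth.
pose Psi := bundle_map (incl_chart A AS y) psi.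
have Psi0 : Psi u0 = cmap (chart_at (total_atlas A F) e) e.
  rewrite /Psi /bundle_map lu0 (incl_chartE hS); congr row_mx.
  apply/rowP => b; rewrite !mxE /psi /=.
  rewrite (cmapK (compatible_chart_at hAS y).1 (cdom_chart_at hAS y)).
  rewrite /tot_incl /= [in RHS](fcoord_sum hD.1 (tagged d) ty) /fcoord !linear_sum /=.
  by apply: eq_bigr => a _; rewrite ru0 !linearZ.
have near1 : \forall u \near u0,
    cinv (chart_at (total_atlas A F) e) (Psi u) =
    tot_incl (cinv (chart_at (total_atlas AS FD) d) u).
  have n1 : \forall u \near lsubmx u0, cinv c (incl_chart A AS y u) = sval (cinv c' u).
    by rewrite lu0; exact: incl_chart_near.
  have n2 : \forall u \near lsubmx u0, fdom F s (sval (cinv c' u)).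
    by rewrite lu0; exact: (sval_mnbhs hA hS (fdom_mnbhs hA hE sy)).
  apply: filterS2 (lsubmx_near n1) (lsubmx_near n2) => u h1 h2.
  rewrite /= /Psi /bundle_map row_mxKl row_mxKr h1 /tot_incl /=; congr Tagged.
  rewrite linear_sum [RHS](fcoord_sum hE _ h2); apply: eq_bigr => b _.
  rewrite mxE /fcoord linear_sum; congr (_ *: _); apply: eq_bigr => a _.
  by rewrite !linearZ.
have dPsi := smooth_at_differentiable (bundle_map_smooth gs psis).
have dL := smooth_at_differentiable Ls; rewrite -Psi0 in dL.
have dLP := differentiable_comp dPsi dL.
rewrite [LHS]dlinE [RHS]dlinE -/u0.
have -> : 'd ((L \o @tot_incl R M E S D) \o cinv (chart_at (total_atlas AS FD) d)
     : 'rV[R]_(k + r) -> R^o) u0 w =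
   'd ((L \o cinv (chart_at (total_atlas A F) e) : 'rV[R]_(m + n) -> R^o) \o Psi) u0 w.
  rewrite -(near_eq_diff dLP) //.
  by apply: filterS near1 => u h; rewrite /= -h.
rewrite (_ : 'd (_ \o Psi) u0 w = 'd (L \o cinv (chart_at (total_atlas A F) e) : 'rV[R]_(m + n) -> R^o)
  (Psi u0) ('d Psi u0 w)); last by rewrite (diff_comp dPsi dL).
rewrite Psi0 (diff_bundle_map gs psis) lu0; congr ('d _ _ _).
congr row_mx; first by rewrite tangent_inclE.
apply/rowP => b; rewrite !mxE; apply: eq_bigr => a _.
rewrite ru0 /psi /= (cmapK (compatible_chart_at hAS y).1 (cdom_chart_at hAS y)).
by rewrite -dlinE.
Qed.

Let AE := total_atlas A (dual_framing F).
Let AES := total_atlas AS (restr_framing (dual_framing F) S).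
Let AD := total_atlas AS (dual_framing FD).

(** The restricted bundle carries the restricted frame, so the matrix of this bundle map is
    constantly the identity and the fibre components are untouched. *)
Lemma tlin_dual_incl (xi : total_space (@restr_fib R M (dual_fib E) S)) w :
  tlin AES AE (@dual_incl R M E S) xi w =
  row_mx (tangent_incl A AS (tag xi) (lsubmx w)) (rsubmx w).
Proof.
set y := tag xi; set s := fpref F (sval y).
have sy : fdom F s (sval y) := fdom_pref hE (sval y).
set c := chart_at A (sval y); set c' := chart_at AS y.
rewrite /tlin lfunE; set u0 := cmap (chart_at AES xi) xi.
have lu0 : lsubmx u0 = cmap c' y by rewrite /u0 row_mxKl.
pose psi (b a : 'I_n) (u : 'rV[R]_k) : R^o := (b == a)%:R.
have psis b a : smooth_at (psi b a) (lsubmx u0) by exact: smooth_at_cst.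
have gs : smooth_at (incl_chart A AS y) (lsubmx u0).
  by rewrite lu0; exact: incl_chart_smooth.
have dPsi := smooth_at_differentiable (bundle_map_smooth gs psis).
rewrite -(near_eq_diff dPsi).
  rewrite (diff_bundle_map gs psis) lu0 tangent_inclE; congr row_mx.
  apply/rowP => b; rewrite !mxE (bigD1 b) //= big1 ?addr0 => [|a ab].
    rewrite /psi eqxx mulr1 mxE [X in _ * X](_ : _ = 0) ?mulr0 ?addr0 //.
    by rewrite (_ : (fun _ => _) = cst 1) // diff_cst.
  rewrite /psi eq_sym (negbTE ab) mulr0 add0r [X in _ * X](_ : _ = 0) ?mulr0 //.
  by rewrite (_ : (fun _ => _) = cst 0) // diff_cst.
have n2 : \forall u \near lsubmx u0, fdom F s (sval (cinv c' u)).
  by rewrite lu0; exact: (sval_mnbhs hA hS (fdom_mnbhs hA hE sy)).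
apply: filterS (lsubmx_near n2) => u h.
rewrite /bundle_map /=; congr row_mx; apply/rowP => b; rewrite !mxE.
rewrite (fcoord_dual hE _ _ h) sum_lfunE; apply: eq_bigr => a _.
by rewrite scale_lfunE dual_frameE (fcoord_frame hE) // eq_sym.
Qed.

(** Over the identity of the base, the matrix is the transpose of that of the inclusion of D, whence
    the swapped indices of [incl_coord]. *)
Lemma tlin_dual_restr (xi : total_space (@restr_fib R M (dual_fib E) S)) w :
  let y := tag xi in
  let t := fpref FD y in
  let s := fpref F (sval y) in
  tlin AES AD (@dual_restr R M E S D) xi w =
  row_mx (lsubmx w)
    (\row_b \sum_a (rsubmx w 0 a * incl_coord t s a b y
       + (tagged xi : dual_fib E (sval y)) (tnth (frame F s (sval y)) a) *
         dlin AS (incl_coord t s a b) y (lsubmx w))).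
Proof.
move=> y t s.
have ty : fdom FD t y := fdom_pref hD.1 y.
have sy : fdom F s (sval y) := fdom_pref hE (sval y).
set c' := chart_at AS y.
rewrite /tlin lfunE; set u0 := cmap (chart_at AES xi) xi.
have lu0 : lsubmx u0 = cmap c' y by rewrite /u0 row_mxKl.
have ru0 a : rsubmx u0 0 a = (tagged xi : dual_fib E (sval y)) (tnth (frame F s (sval y)) a).
  by rewrite /u0 row_mxKr mxE -(fcoord_dual hE a _ sy).
pose psi b a : 'rV[R]_k -> R^o := incl_coord t s a b \o cinv c'.
have psis b a : smooth_at (psi b a) (lsubmx u0).
  by rewrite lu0; exact: (sub_incl_smooth hS hD b a ty sy).
have gs : smooth_at (id : 'rV[R]_k -> 'rV[R]_k) (lsubmx u0).
  exact: (smooth_at_linear_rV (idfun : {linear 'rV[R]_k -> 'rV[R]_k})).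
have dPsi := smooth_at_differentiable (bundle_map_smooth gs psis).
rewrite -(near_eq_diff dPsi).
  rewrite (diff_bundle_map gs psis) lu0 diff_val; congr row_mx.
  apply/rowP => b; rewrite !mxE; apply: eq_bigr => a _.
  rewrite ru0 /psi /= (cmapK (compatible_chart_at hAS y).1 (cdom_chart_at hAS y)).
  by rewrite -dlinE.
have n1 : \forall u \near lsubmx u0, cdom c' (cinv c' u) /\ cmap c' (cinv c' u) = u.
  by rewrite lu0; exact: chart_inv_near (compatible_chart_at hAS y).1 (cdom_chart_at hAS y).
have n2 : \forall u \near lsubmx u0, fdom FD t (cinv c' u).
  by rewrite lu0; exact: (fdom_mnbhs hAS hD.1 ty).
apply: filterS2 (lsubmx_near n1) (lsubmx_near n2) => u [_ h1] h2.
rewrite /bundle_map /= h1; congr row_mx; apply/rowP => b; rewrite !mxE.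
rewrite (fcoord_dual hD.1 _ _ h2) comp_lfunE sum_lfunE; apply: eq_bigr => a _.
by rewrite scale_lfunE dual_frameE.
Qed.

End TangentMaps.

(** * The nonholonomic Tulczyjew differential *)

Section Nonholonomic.
Variables (R : realType) (m : nat) (M : Type) (A : atlas R M m).
Hypothesis hM : is_manifold A.
Variables (n : nat) (E : M -> vectType R) (F : framing E n).
Hypothesis hE : is_vbundle A F.
Variable eps : algebroid m E.
Hypothesis heps : is_algebroid A F eps.
Variable G : forall x, E x -> E x -> R.
Hypothesis hG : is_bundle_metric A F G.
Variable V : M -> R.
Hypothesis hV : smooth_fun A (V:=R^o) setT V.
Variables (S : set M) (k : nat) (AS : atlas R {x : M | S x} k).
Hypothesis hS : is_submanifold A AS.
Variable D : forall y : {x : M | S x}, {vspace E (sval y)}.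
Variables (r : nat) (FD : framing (sub_fib D) r).
Hypothesis hD : is_subbundle F AS FD.
Hypothesis hrho : maps_into_tangent A AS D (lanchor eps).
Hypothesis hsigma : maps_into_tangent A AS D (ranchor eps).
Variable Dperp : forall y : {x : M | S x}, {vspace E (sval y)}.
Hypothesis hDperp : forall y e, e \in Dperp y <->
  forall d, d \in D y -> G d e = 0.

#[local] Existing Instance mnbhs_filter.

Let hAS : is_manifold AS := hS.1.
Let L := mechanical_lagrangian G V.
Let epsP := nh_restriction A F AS D Dperp eps.

Lemma sub_inclE y (v : sub_fib D y) : sub_incl D y v = vsval v.
Proof. by rewrite lfunE. Qed.

(** [^-1%VF] is undone by the map itself only on the image; the admissibility hypotheses place the
    anchors of vectors of D in that image. *)
Lemma tangent_inclK (phi : forall x, 'Hom(E x, @tfib R M m x)) y (v : sub_fib D y) :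
  maps_into_tangent A AS D phi ->
  tangent_incl A AS y ((tangent_incl A AS y)^-1%VF (phi (sval y) (sub_incl D y v)))
  = phi (sval y) (sub_incl D y v).
Proof.
move=> h; apply: limg_lfunVK; apply: (subvP (h y)); apply: memv_img.
by rewrite sub_inclE subvsP.
Qed.

Variable d : total_space (sub_fib D).
Let y := tag d.
Let x := sval y.
Let t := fpref FD y.
Let s := fpref F x.
Let e0 := sub_incl D y (tagged d).

Let ty : fdom FD t y. Proof. exact: fdom_pref hD.1 y. Qed.
Let sx : fdom F s x. Proof. exact: fdom_pref hE x. Qed.

Let f b : sub_fib D y := tnth (frame FD t y) b.
Let ef b : E x := tnth (frame F s x) b.
Let phi b a := incl_coord t s b a.
Let coordD a : R := fcoord FD t a (tagged d).

(** Exactly the sections chosen inside [structure_fun] for E, so that [structure_fun_frame] needs no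
    comparison of choices. *)
Let e : 'I_n -> section E :=
  fun c => globalize A F (fun z => tnth (frame F s z) c) x.
(** The frame of D is globalized over the submanifold and then extended to M because the structure
    functions of [epsP] unfold to brackets of precisely these sections. *)
Let X : 'I_r -> section E :=
  fun b => extension A F AS (globalize AS FD (fun z => tnth (frame FD t z) b) y) y.

Lemma global_frame : (forall c, smooth_section A F (e c)) /\
  mnbhs A x [set z | forall c, e c z = tnth (frame F s z) c].
Proof.
have h c : smooth_section A F (e c) /\ mnbhs A x [set z | e c z = tnth (frame F s z) c].
  apply: (globalizeP hM hE).
  by apply: filterS (fdom_mnbhs hM hE sx) => z sz; exact: smooth_section_at_frame.
split=> [c|]; first by case: (h c).
by apply: (@filter_forall _ _ (fun c z => e c z = tnth (frame F s z) c) (mnbhs A x)) => c; case: (h c).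
Qed.

Lemma extended_frame b : smooth_section A F (X b) /\
  mnbhs AS y [set z | X b (sval z) = sub_incl D z (tnth (frame FD t z) b)].
Proof.
have [gs gE] : smooth_section AS FD (globalize AS FD (fun z => tnth (frame FD t z) b) y) /\
    mnbhs AS y [set z | globalize AS FD (fun z => tnth (frame FD t z) b) y z =
                        tnth (frame FD t z) b].
  apply: (globalizeP hAS hD.1).
  by apply: filterS (fdom_mnbhs hAS hD.1 ty) => z tz; exact: (smooth_section_at_frame hAS hD.1).
have [hX XE] : smooth_section A F (X b) /\ mnbhs AS y [set z | X b (sval z) =
    sub_incl D z (globalize AS FD (fun z => tnth (frame FD t z) b) y z)].
  apply: (extensionP hM hE hS hD).
  by apply: filterE => z; move: z; exact/(smooth_section_atP hAS hD.1).
by split=> //; apply: filterS2 XE gE => z /= -> ->.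
Qed.

Lemma extended_frame_at b : X b x = sub_incl D y (f b).
Proof. by have [_ /(mnbhs_singleton hAS)] := extended_frame b. Qed.

Lemma coord_extended_frame a b : fcoord F s a (X b x) = phi a b y.
Proof. by rewrite extended_frame_at. Qed.

Lemma frame_metric_sum (w : E x) : G e0 w = \sum_b fcoord F s b w * G e0 (ef b).
Proof.
have [Gl Gs _ _] := hG.
by rewrite {1}(fcoord_sum hE w sx) (metric_sum (Gl x) (Gs x)).
Qed.

Lemma structure_fun_metric a b :
  \sum_c structure_fun AS epsP t a b c y * G e0 (sub_incl D y (f c)) =
  G e0 (bracket eps (X a) (X b) x).
Proof.
have [Gl Gs Gp _] := hG.
rewrite -(metric_sum (Gl x) (Gs x)).
pose w : sub_fib D y := local_bracket AS FD epsP (fun z => tnth (frame FD t z) a)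
  (fun z => tnth (frame FD t z) b) y.
transitivity (G e0 (sub_incl D y w)).
  congr (G _ _); rewrite [in RHS](fcoord_sum hD.1 w ty) linear_sum.
  by apply: eq_bigr => c _; rewrite linearZ.
rewrite sub_inclE /w /local_bracket /= vsprojK ?memv_pi //.
have e0D : e0 \in D y by rewrite /e0 sub_inclE subvsP.
exact: (ortho_proj (Gl x) (Gs x) (Gp x) (@hDperp y) _ e0D).
Qed.

(** [X b] is an arbitrary choice off the submanifold; a derivative along a tangent vector of the
    submanifold sees only the restriction, which near y is the frame section of D. *)
Lemma dlin_extended_frame c b (v : 'rV[R]_k) :
  dlin A (fun z => fcoord F s c (X b z)) x (tangent_incl A AS y v) = dlin AS (phi c b) y v.
Proof.
have [/(smooth_section_atP hM hE) hX XE] := extended_frame b.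
have sm : msmooth A (fun z => fcoord F s c (X b z)) x by exact: hX.
rewrite -(dlin_sval hM hS v sm).
have -> // : dlin AS ((fun z => fcoord F s c (X b z)) \o sval) y = dlin AS (phi c b) y.
apply: dlin_near; first exact: (msmooth_sval hM hS sm).
by apply: filterS XE => z /= ->.
Qed.

Let rho_lift b : 'rV[R]_k := lanchor epsP y (f b).
Let sigma_lift b : 'rV[R]_k := ranchor epsP y (f b).

Lemma tangent_rho_lift b :
  tangent_incl A AS y (rho_lift b) = lanchor eps x (sub_incl D y (f b)).
Proof. by rewrite /rho_lift /= !comp_lfunE tangent_inclK. Qed.

Lemma tangent_sigma_lift b :
  tangent_incl A AS y (sigma_lift b) = ranchor eps x (sub_incl D y (f b)).
Proof. by rewrite /sigma_lift /= !comp_lfunE tangent_inclK. Qed.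

Lemma structure_fun_frame c c' :
  G e0 (bracket eps (e c) (e c') x) =
  \sum_b structure_fun A eps s c c' b x * G e0 (ef b).
Proof. by rewrite frame_metric_sum. Qed.

Lemma bracket_extended_frame a b :
  G e0 (bracket eps (X a) (X b) x) =
    \sum_c dlin AS (phi c b) y (rho_lift a) * G e0 (ef c)
    - \sum_c dlin AS (phi c a) y (sigma_lift b) * G e0 (ef c)
    + \sum_c \sum_c' (phi c a y * phi c' b y) *
        \sum_i structure_fun A eps s c c' i x * G e0 (ef i).
Proof.
have [Gl Gs _ _] := hG; have [es eE] := global_frame.
have ex c : e c x = ef c by have := mnbhs_singleton hM eE; exact.
rewrite (bracket_frame hM hE heps (extended_frame a).1 (extended_frame b).1 sx es eE).
have lin := metric_sum (Gl x) (Gs x) e0.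
have add := metricDr (Gl x) (Gs x) e0.
have opp u : G e0 (- u) = - G e0 u.
  have := lin 1%N (fun=> -1) (fun=> u); rewrite !big_ord1 scaleN1r mulN1r; exact.
rewrite !add opp !lin; congr (_ - _ + _).
- apply: eq_bigr => c _; rewrite ex -dlin_extended_frame tangent_rho_lift.
  by rewrite extended_frame_at.
- apply: eq_bigr => c _; rewrite ex -dlin_extended_frame tangent_sigma_lift.
  by rewrite extended_frame_at.
under eq_bigr => c _ do under eq_bigr => c' _ do rewrite !coord_extended_frame.
rewrite (eq_bigr (fun c => 1 *: \sum_c' (phi c a y * phi c' b y) *: bracket eps (e c) (e c') x));
  last by move=> c _; rewrite scale1r.
rewrite lin; apply: eq_bigr => c _; rewrite mul1r lin; apply: eq_bigr => c' _.
by rewrite structure_fun_frame.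
Qed.

Lemma lfun_lshift_sum p q (h : 'Hom('rV[R]_(p + q), R^o)) (w : 'rV[R]_p) :
  \sum_i w 0 i * h (delta_mx 0 (lshift q i)) = h (row_mx w 0).
Proof.
have -> : row_mx w (0 : 'rV[R]_q) = \sum_i w 0 i *: delta_mx 0 (lshift q i).
  rewrite {1}(row_sum_delta w); apply/rowP => j; rewrite summxE.
  rewrite -(splitK j); case: (fintype.split j) => i /=.
    rewrite row_mxEl summxE; apply: eq_bigr => i' _.
    by rewrite !mxE (inj_eq (@lshift_inj _ _)).
  rewrite row_mxEr mxE big1 // => i' _.
  by rewrite !mxE eq_rlshift andbF mulr0.
by rewrite linear_sum; apply: eq_bigr => i _; rewrite linearZ.
Qed.

Lemma delta_rshift_row p q (i : 'I_q) :
  delta_mx 0 (rshift p i) = row_mx 0 (delta_mx 0 i) :> 'rV[R]_(p + q).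
Proof.
apply/rowP => j; rewrite -(splitK j); case: (fintype.split j) => l /=.
  by rewrite row_mxEl !mxE eq_lrshift andbF.
by rewrite row_mxEr !mxE (inj_eq (@rshift_inj _ _)).
Qed.

Let dL := dlin (total_atlas A F) L (tot_incl d).
Let dl := dlin (total_atlas AS FD) (L \o @tot_incl R M E S D) d.

Lemma dL_fibre (w : 'rV[R]_n) : dL (row_mx 0 w) = \sum_a w 0 a * G e0 (ef a).
Proof.
have [Gl Gs _ _] := hG.
by rewrite /dL (dlin_mechanical_fibre hM hE hG hV) (metric_sum (Gl x) (Gs x)).
Qed.

Lemma momentum b : dL (delta_mx 0 (rshift m b)) = G e0 (ef b).
Proof.
rewrite delta_rshift_row dL_fibre (bigD1 b) //= big1 ?addr0 => [|a ab].
  by rewrite !mxE !eqxx mul1r.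
by rewrite !mxE (negbTE ab) andbF mul0r.
Qed.

Lemma sub_momentum b : dl (delta_mx 0 (rshift k b)) = G e0 (sub_incl D y (f b)).
Proof.
rewrite delta_rshift_row /dl (dlin_tot_incl hM hE hS hD); last first.
  exact: (mechanical_smooth hM hE hG hV).
rewrite row_mxKl row_mxKr linear0 -/dL dL_fibre frame_metric_sum.
apply: eq_bigr => c _; congr (_ * _); rewrite mxE (bigD1 b) //= big1 ?addr0 => [|a ab].
  by rewrite !mxE !eqxx mul1r linear0 mulr0 addr0.
by rewrite !mxE (negbTE ab) andbF mul0r linear0 mulr0 addr0.
Qed.

Lemma sub_force (v : 'rV[R]_k) : dl (row_mx v 0) =
  dL (row_mx (tangent_incl A AS y v) 0)
  + \sum_c (\sum_a coordD a * dlin AS (phi c a) y v) * G e0 (ef c).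
Proof.
rewrite /dl (dlin_tot_incl hM hE hS hD); last exact: (mechanical_smooth hM hE hG hV).
rewrite row_mxKl row_mxKr -/dL.
rewrite -[X in row_mx X _]addr0 -[X in row_mx _ X]add0r -add_row_mx linearD.
congr (_ + _); apply: etrans (dL_fibre _) _; apply: eq_bigr => c _; congr (_ * _).
by rewrite mxE; apply: eq_bigr => a _; rewrite mxE mul0r add0r.
Qed.

(** The base velocity as a tangent vector of the submanifold: the lift of $\rho(e_0)$, which
    inverting the tangent map of the inclusion has to return. *)
Let u0 := \sum_c coordD c *: rho_lift c.

Lemma velocity : tangent_incl A AS y u0 = lanchor eps x e0.
Proof.
rewrite linear_sum /e0 (fcoord_sum hD.1 (tagged d) ty) !linear_sum.
by apply: eq_bigr => c _; rewrite !linearZ; congr (_ *: _); exact: tangent_rho_lift.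
Qed.

(** The fibre components of $\Lambda_L$ at [e0], with the momenta already replaced by their values
    [G e0 (ef c)]. *)
Let zeta a' : R :=
  \sum_a \sum_c structure_fun A eps s a a' c x * fcoord F s a e0 * G e0 (ef c)
  + \sum_i (ranchor eps x (ef a') : 'rV[R]_m) 0 i * dL (delta_mx 0 (lshift n i)).

(** The left side is the fibre part of the tangent map of $i_D^*$ applied to the vector with
    components [u0] and [zeta]; the right side is the fibre part of $\Lambda_l$. Both reduce to a
    structure function term ([str]), the $\rho$-derivatives of phi ([vel]) and dL along the lift of
    $\sigma(f_b)$ ([anc]). *)
Lemma force_balance b :
  \sum_a (zeta a * phi a b y + G e0 (ef a) * dlin AS (phi a b) y u0) =
  \sum_a \sum_c structure_fun AS epsP t a b c y * coordD a * G e0 (sub_incl D y (f c))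
  + \sum_i sigma_lift b 0 i * dl (delta_mx 0 (lshift r i)).
Proof.
have vel : \sum_a G e0 (ef a) * dlin AS (phi a b) y u0 =
    \sum_a coordD a * \sum_c dlin AS (phi c b) y (rho_lift a) * G e0 (ef c).
  under [RHS]eq_bigr => a _ do rewrite mulr_sumr.
  rewrite exchange_big /=; apply: eq_bigr => c _.
  rewrite /u0 linear_sum mulr_sumr; apply: eq_bigr => a _.
  by rewrite linearZ /= mulrC mulrA.
have Ya c : fcoord F s c e0 = \sum_a coordD a * phi c a y.
  rewrite /e0 {1}(fcoord_sum hD.1 (tagged d) ty) /fcoord !linear_sum.
  by apply: eq_bigr => a _; rewrite !linearZ.
have str : \sum_c' (\sum_c \sum_i structure_fun A eps s c c' i x * fcoord F s c e0 * G e0 (ef i))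
      * phi c' b y =
    \sum_a coordD a * \sum_c \sum_c' (phi c a y * phi c' b y) *
      \sum_i structure_fun A eps s c c' i x * G e0 (ef i).
  transitivity (\sum_c' \sum_c \sum_a coordD a * ((phi c a y * phi c' b y) *
      \sum_i structure_fun A eps s c c' i x * G e0 (ef i))).
    apply: eq_bigr => c' _; rewrite mulr_suml; apply: eq_bigr => c _.
    transitivity (fcoord F s c e0 * (phi c' b y *
        \sum_i structure_fun A eps s c c' i x * G e0 (ef i))).
      rewrite mulr_suml !mulr_sumr; apply: eq_bigr => i _; ring.
    by rewrite Ya mulr_suml; apply: eq_bigr => a _; rewrite !mulrA.
  rewrite exchange_big /=; under eq_bigr => c _ do rewrite exchange_big /=.
  rewrite exchange_big /=; apply: eq_bigr => a _; rewrite mulr_sumr.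
  by apply: eq_bigr => c _; rewrite mulr_sumr.
have anc : \sum_a (\sum_i (ranchor eps x (ef a) : 'rV[R]_m) 0 i * dL (delta_mx 0 (lshift n i)))
      * phi a b y = dL (row_mx (tangent_incl A AS y (sigma_lift b)) 0).
  rewrite tangent_sigma_lift (fcoord_sum hE (sub_incl D y (f b)) sx) linear_sum.
  rewrite -(lfun_lshift_sum dL).
  under [RHS]eq_bigr => i _ do rewrite summxE mulr_suml.
  rewrite exchange_big /=; apply: eq_bigr => a _; rewrite mulr_suml.
  apply: eq_bigr => i _; rewrite linearZ mulrC mulrA; congr (_ * _).
  exact/esym/mxE.
rewrite big_split /= vel /zeta.
under eq_bigr => a _ do rewrite mulrDl.
rewrite big_split /= str anc.
rewrite (lfun_lshift_sum dl) sub_force.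
have strD : \sum_a \sum_c structure_fun AS epsP t a b c y * coordD a * G e0 (sub_incl D y (f c)) =
    \sum_a coordD a * G e0 (bracket eps (X a) (X b) x).
  apply: eq_bigr => a _; rewrite -structure_fun_metric mulr_sumr.
  by apply: eq_bigr => c _; rewrite mulrCA mulrA.
rewrite strD.
have sig : \sum_c (\sum_a coordD a * dlin AS (phi c a) y (sigma_lift b)) * G e0 (ef c) =
    \sum_a coordD a * \sum_c dlin AS (phi c a) y (sigma_lift b) * G e0 (ef c).
  under eq_bigr => c _ do rewrite mulr_suml.
  rewrite exchange_big /=; apply: eq_bigr => a _; rewrite mulr_sumr.
  by apply: eq_bigr => c _; rewrite mulrA.
rewrite sig.
(* The $\sigma$-derivatives of phi now occur twice on the right, with a minus sign from the bracket
   and a plus sign from [sub_force], and cancel. *)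
under [X in _ = X + _]eq_bigr => a _ do rewrite bracket_extended_frame !mulrDr mulrN.
rewrite !big_split sumrN /=; ring.
Qed.

Lemma nh_tulczyjew_diff_mechanical :
  nh_tulczyjew_diff A F AS FD eps L d =
  tulczyjew_diff AS FD epsP (L \o @tot_incl R M E S D) d.
Proof.
pose Xi : dual_fib E x := \sum_b dL (delta_mx 0 (rshift m b)) *:
  tnth (frame (dual_framing F) s x) b.
have XiE w : Xi w = G e0 w.
  rewrite sum_lfunE frame_metric_sum; apply: eq_bigr => b _.
  by rewrite scale_lfunE dual_frameE momentum /GRing.scale /= mulrC.
pose xi : total_space (@restr_fib R M (dual_fib E) S) :=
  existT (@restr_fib R M (dual_fib E) S) y Xi.
pose eta : dual_fib (sub_fib D) y := \sum_b dl (delta_mx 0 (rshift k b)) *: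
  tnth (frame (dual_framing FD) t y) b.
(* Tangent vectors are dependent pairs, so the base points in D^* are identified first; only then
   can the components be compared. *)
have baseE : dual_restr D xi = Tagged (dual_fib (sub_fib D)) eta.
  rewrite /dual_restr; congr Tagged; apply/lfunP => v; rewrite comp_lfunE.
  have [Gl Gs _ _] := hG.
  rewrite [LHS]XiE {1}(fcoord_sum hD.1 v ty) linear_sum.
  under eq_bigr => b _ do rewrite linearZ.
  rewrite (metric_sum (Gl x) (Gs x)) sum_lfunE; apply: eq_bigr => b _.
  by rewrite scale_lfunE dual_frameE sub_momentum /GRing.scale /= mulrC.
pose tl1 := tlin (total_atlas AS (restr_framing (dual_framing F) S))
  (total_atlas A (dual_framing F)) (@dual_incl R M E S) xi.
pose tl2 := tlin (total_atlas AS (restr_framing (dual_framing F) S))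
  (total_atlas AS (dual_framing FD)) (@dual_restr R M E S D) xi.
have lhsE : nh_tulczyjew_diff A F AS FD eps L d = tvec (dual_restr D xi)
   (tl2 (tl1^-1%VF (row_mx (\sum_c fcoord F s c e0 *: (lanchor eps x (ef c) : 'rV[R]_m))
     (\row_a' (\sum_a \sum_c structure_fun A eps s a a' c x * fcoord F s a e0
          * dL (delta_mx 0 (rshift m c))
        + \sum_i (ranchor eps x (ef a') : 'rV[R]_m) 0 i * dL (delta_mx 0 (lshift n i))))))) by [].
have rhsE : tulczyjew_diff AS FD epsP (L \o @tot_incl R M E S D) d =
   tvec (Tagged (dual_fib (sub_fib D)) eta)
   (row_mx (\sum_c coordD c *: rho_lift c)
     (\row_b (\sum_a \sum_c structure_fun AS epsP t a b c y * coordD a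
          * dl (delta_mx 0 (rshift k c))
        + \sum_i sigma_lift b 0 i * dl (delta_mx 0 (lshift r i))))) by [].
rewrite lhsE rhsE baseE; congr tvec.
have -> : \sum_c fcoord F s c e0 *: (lanchor eps x (ef c) : 'rV[R]_m) =
    tangent_incl A AS y u0.
  rewrite velocity {2}(fcoord_sum hE e0 sx) linear_sum.
  by apply: eq_bigr => c _; rewrite linearZ.
have -> : (\row_a' (\sum_a \sum_c structure_fun A eps s a a' c x * fcoord F s a e0
      * dL (delta_mx 0 (rshift m c))
    + \sum_i (ranchor eps x (ef a') : 'rV[R]_m) 0 i * dL (delta_mx 0 (lshift n i))))
    = \row_a' zeta a'.
  apply/rowP => a'; rewrite !mxE; congr (_ + _).
  by apply: eq_bigr => a _; apply: eq_bigr => c _; rewrite momentum.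
have tl1E w : tl1 w = row_mx (tangent_incl A AS y (lsubmx w)) (rsubmx w).
  exact: (tlin_dual_incl hM hE hS).
(* Injectivity makes [tl1^-1] a left inverse, so it is enough to write the vector as [tl1] of the
   one with base part [u0] and fibre part [zeta]. *)
have tl1_inj : lker tl1 == 0%VS.
  apply/lker0P => w w'; rewrite !tl1E => /eq_row_mx [/(lker0P (tangent_incl_inj hM hS y)) h1 h2].
  by rewrite -[w]hsubmxK h1 h2 hsubmxK.
rewrite (_ : row_mx _ _ = tl1 (row_mx u0 (\row_a zeta a))); last first.
  by rewrite tl1E row_mxKl row_mxKr.
rewrite lker0_lfunK // /tl2 (tlin_dual_restr hE hS hD) row_mxKl row_mxKr.
congr row_mx; apply/rowP => b; rewrite !mxE.
apply: etrans (etrans _ (force_balance b)) _.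
  by apply: eq_bigr => a _; rewrite mxE -XiE.
congr (_ + _); apply: eq_bigr => a _; apply: eq_bigr => c _.
by rewrite sub_momentum.
Qed.

End Nonholonomic.

Theorem theorem5p1 (R : realType)
    (* the manifold M, the vector bundle E and the algebroid structure on E *)
    (m : nat) (M : Type) (A : atlas R M m) (hM : is_manifold A)
    (n : nat) (E : M -> vectType R) (F : framing E n) (hE : is_vbundle A F)
    (eps : algebroid m E) (heps : is_algebroid A F eps)
    (* the metric and the potential *)
    (G : forall x, E x -> E x -> R) (hG : is_bundle_metric A F G)
    (V : M -> R) (hV : smooth_fun A (V:=R^o) setT V)
    (* the subbundle D over the submanifold S *)
    (S : set M) (k : nat) (AS : atlas R {x : M | S x} k)
    (hS : is_submanifold A AS)
    (D : forall y : {x : M | S x}, {vspace E (sval y)}) (r : nat)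
    (FD : framing (sub_fib D) r) (hD : is_subbundle F AS FD)
    (hrho : maps_into_tangent A AS D (lanchor eps))
    (hsigma : maps_into_tangent A AS D (ranchor eps))
    (* the orthogonal complement of D *)
    (Dperp : forall y : {x : M | S x}, {vspace E (sval y)})
    (hDperp : forall y e, e \in Dperp y <->
       forall d, d \in D y -> G (sval y) d e = 0) :
  let L := mechanical_lagrangian G V in
  let epsP := nh_restriction A F AS D Dperp eps in
  let l : total_space (sub_fib D) -> R := L \o @tot_incl R M E S D in
  (forall d : total_space (sub_fib D),
     nh_tulczyjew_diff A F AS FD eps L d = tulczyjew_diff AS FD epsP l d) /\
  (forall (I : set R) (gamma : R -> total_space (sub_fib D)),
     open I -> is_interval I -> smooth_curve (total_atlas AS FD) I gamma ->
     (nh_euler_lagrange A F AS FD eps L I gamma <->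
      euler_lagrange AS FD epsP l I gamma)).
Proof.
move=> L epsP l.
have diffE d : nh_tulczyjew_diff A F AS FD eps L d = tulczyjew_diff AS FD epsP l d.
  exact: (nh_tulczyjew_diff_mechanical hM hE heps hG hV hS hD hrho hsigma hDperp).
have legE : nh_legendre A F eps L = legendre AS FD epsP l.
  by apply/funext => d; exact: (congr1 (fun w => tag w) (diffE d)).
split=> // I gamma _ _ _; rewrite /nh_euler_lagrange /euler_lagrange legE.
by split=> h t It; rewrite h.
Qed.
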